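(* Let $N\ge 3$, let $f:\mathbb{R}^d\to\mathbb{R}^d$ be smooth, $\lambda_a,\lambda_x>0$, $\bar q_0\in\mathbb{R}^d$, and let $a_1,\dots,a_N\in\mathbb{R}^d$ satisfy $\sum_{i=1}^N a_i=0$. Let $0\le x_1<\dots<x_N<1$, and put $q(x)=\sum_{i=1}^N a_i\varphi(x-x_i)+\bar q_0$. Suppose $(\dot a_i,\dot x_i)_{i=1}^N\in(\mathbb{R}^d\times\mathbb{R})^N$ minimizes $$\int_{\mathbb{T}}\Big|\sum_{i=1}^{N}\big[\varphi(x-x_i)\dot a_i-a_i\varphi'(x-x_i)\dot x_i\big]+\partial_x f(q(x))\Big|^2dx+\lambda_a\sum_{i=1}^N|\dot a_i|^2+\lambda_x\sum_{i=1}^N|\dot x_i|^2$$ subject to $\sum_{i=1}^N\dot a_i=0$, and let $2\alpha\in\mathbb{R}^d$ be the corresponding Lagrange multiplier (the Lagrangian being the objective plus $2\alpha\cdot\sum_i\dot a_i$). Define $$\mathfrak{F}(\xi)=-\int_{\mathbb{T}}\varphi(x-\xi)\,\partial_x f(q(x))\,dx,\qquad \mathfrak{h}(\xi)=\sum_{j=1}^N\big[\dot a_j\,g(\xi-x_j)-a_j\dot x_j\,g'(\xi-x_j)\big]+\alpha,\qquad \mathfrak{D}=\mathfrak{F}-\mathfrak{h}.$$ Then, for every $i=1,\dots,N$, $$\mathfrak{D}(x_i)=\lambda_a\dot a_i,\qquad a_i\cdot\mathfrak{D}'(x_i)=\lambda_x\dot x_i,$$ and the vectors $Z_i=\begin{bmatrix}\mathfrak{D}(x_i)\\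 \mathfrak{D}'(x_i)\end{bmatrix}\in\mathbb{R}^{2d}$ satisfy the periodic block tridiagonal linear system $$\mathbb{G}_{i,i-1}Z_{i-1}+\mathbb{G}_{i,i}Z_i+\mathbb{G}_{i,i+1}Z_{i+1}=R_i\qquad(i=1,\dots,N,\ \text{indices modulo }N),$$ where $$\mathbb{G}_{i,i}=\begin{bmatrix}12(\delta_{i_+}^{-3}+\delta_{i_-}^{-3})&6(\delta_{i_+}^{-2}-\delta_{i_-}^{-2})\\6(\delta_{i_+}^{-2}-\delta_{i_-}^{-2})&4(\delta_{i_+}^{-1}+\delta_{i_-}^{-1})\end{bmatrix}\otimes\mathbb{I}_d+\begin{bmatrix}\frac1{\lambda_a}\mathbb{I}_d&0\\0&\frac1{\lambda_x}a_ia_i^T\end{bmatrix},$$ $$\mathbb{G}_{i,i-1}=\begin{bmatrix}-12\,\delta_{i_-}^{-3}&-6\,\delta_{i_-}^{-2}\\6\,\delta_{i_-}^{-2}&2\,\delta_{i_-}^{-1}\end{bmatrix}\otimes\mathbb{I}_d,\qquad \mathbb{G}_{i,i+1}=\begin{bmatrix}-12\,\delta_{i_+}^{-3}&6\,\delta_{i_+}^{-2}\\-6\,\delta_{i_+}^{-2}&2\,\delta_{i_+}^{-1}\end{bmatrix}\otimes\mathbb{I}_d,$$ and the right-hand side is given by the local expressions $$R_i=\begin{bmatrix}A_{i+1/2}-A_{i-1/2}\\-\big(B_{i+1/2}-A_{i+1/2}\,\delta_{i_+}/2\big)+\big(B_{i-1/2}+A_{i-1/2}\,\delta_{i_-}/2\big)\end{bmatrix},$$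 $$A_{i+1/2}=\frac1{\delta_{i_+}^2}\int_0^1 6s(1-s)\,\partial_s^2\big[f\big(q(x_i)+s(q(x_{i+1})-q(x_i))\big)\big]\,ds,\qquad B_{i+1/2}=\frac{f(q(x_{i+1}))-f(q(x_i))}{\delta_{i_+}}.$$
   Context: $\mathbb{T}=\mathbb{R}/\mathbb{Z}$, and $\{x\}\in[0,1)$ is the fractional part of $x$. The kernel $\varphi:\mathbb{T}\to\mathbb{R}$ is $\varphi(x)=\frac12\{x\}^2-\frac12\{x\}+\frac1{12}$, and $g(x)=\int_{\mathbb{T}}\varphi(x+y)\varphi(y)\,dy=-\frac1{24}\{x\}^4+\frac1{12}\{x\}^3-\frac1{24}\{x\}^2+\frac1{720}$ is its autocorrelation. Knots are extended periodically to $i\in\mathbb{Z}$ by $x_{i+mN}=x_i+m$ for $m\in\mathbb{Z}$, and $\delta_{i_\pm}=|x_{i\pm1}-x_i|$; quantities such as $A_{i+1/2}$, $B_{i+1/2}$, $Z_i$ are indexed periodically modulo $N$. $\mathbb{I}_d$ is the $d\times d$ identity matrix and $\otimes$ is the Kronecker product. *)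

(* Defs.v *)
From HB Require Import structures.
From mathcomp Require Import all_boot all_order all_algebra.
From mathcomp Require Import mxtens.
From mathcomp Require Import all_classical all_reals all_analysis.

Set Implicit Arguments.
Unset Strict Implicit.
Unset Printing Implicit Defensive.

Import Order.TTheory GRing.Theory Num.Theory.
Import numFieldNormedType.Exports.

Local Open Scope classical_set_scope.
Local Open Scope ring_scope.

(* Conventions.
   - Functions on the torus R/Z are 1-periodic functions on R, and the integral
     over R/Z is the Lebesgue integral over the period [0, 1].
   - R^d is 'cV[R]_d; its library norm is the sup norm, so the Euclidean inner
     product is defined separately.  Vector-valued functions of a real variable
     are differentiated with the library's derive1.
   - phi and q have corners, at the integers and at the knots respectively.
     There derive1 takes a junk value, but the derivatives of phi and of
     f \o q only occur under integrals, which ignore finite sets.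
   - Knots are indexed by 'I_N (that is 0, ..., N-1); ordS and ord_pred are the
     cyclic successor and predecessor, i.e. i + 1 and i - 1 modulo N. *)

Fixpoint class_C (R : realType) (d m k : nat)
    (F : 'cV[R]_d -> 'cV[R]_m) : Prop :=
  if k is k'.+1 then
    (forall u, differentiable F u) /\
    (forall v, class_C k' (fun u => 'D_v F u))
  else continuous F.

Definition smooth (R : realType) (d m : nat) (F : 'cV[R]_d -> 'cV[R]_m) : Prop :=
  forall k, class_C k F.

Definition dotv (R : realType) (d : nat) (u v : 'cV[R]_d) : R :=
  \sum_k u k 0 * v k 0.

Definition vint01 (R : realType) (d : nat) (F : R -> 'cV[R]_d) : 'cV[R]_d :=
  \col_k \int[lebesgue_measure]_(t in `[0, 1]) F t k 0.

Definition frac (R : realType) (t : R) : R := t - (Num.floor t)%:~R.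

Definition phi (R : realType) (t : R) : R :=
  frac t ^+ 2 / 2 - frac t / 2 + 12^-1.

(* On R/Z this equals
   - {t}^4 / 24 + {t}^3 / 12 - {t}^2 / 24 + 1 / 720. *)
Definition g (R : realType) (t : R) : R :=
  \int[lebesgue_measure]_(y in `[0, 1]) (phi (t + y) * phi y).

Section Profile.
Context (R : realType) (d N : nat).
Implicit Types (f : 'cV[R]_d -> 'cV[R]_d) (qbar : 'cV[R]_d).
Implicit Types (a b : 'I_N -> 'cV[R]_d) (x y : 'I_N -> R).

Definition profile a x qbar (t : R) : 'cV[R]_d :=
  \sum_i phi (t - x i) *: a i + qbar.

Definition flux_deriv f a x qbar : R -> 'cV[R]_d := derive1 (f \o profile a x qbar).

(* In the following two definitions (b, y) is the trial value for the
   velocities of (a, x). *)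
Definition residual f a x qbar b y (t : R) : 'cV[R]_d :=
  \sum_i (phi (t - x i) *: b i - (derive1 (@phi R) (t - x i) * y i) *: a i)
  + flux_deriv f a x qbar t.

Definition objective f (la lx : R) a x qbar b y : R :=
  \int[lebesgue_measure]_(t in `[0, 1])
     dotv (residual f a x qbar b y t) (residual f a x qbar b y t)
  + la * \sum_i dotv (b i) (b i) + lx * \sum_i y i ^+ 2.

Definition is_constrained_minimizer f la lx a x qbar b y : Prop :=
  \sum_i b i = 0 /\
  forall b' y', \sum_i b' i = 0 ->
    objective f la lx a x qbar b y <= objective f la lx a x qbar b' y'.

Definition lagrangian f la lx a x qbar (mu : 'cV[R]_d) b y : R :=
  objective f la lx a x qbar b y + dotv mu (\sum_i b i).

(* mu is a Lagrange multiplier at (b, y): every directional derivative of the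
   Lagrangian with multiplier mu vanishes there, in all directions of
   (R^d x R)^N. *)
Definition is_multiplier f la lx a x qbar b y (mu : 'cV[R]_d) : Prop :=
  forall b' y', is_derive (0 : R) (1 : R)
    (fun s : R => lagrangian f la lx a x qbar mu
                    (fun i => b i + s *: b' i) (fun i => y i + s * y' i)) 0.

Definition Ffun f a x qbar (xi : R) : 'cV[R]_d :=
  - vint01 (fun t => phi (t - xi) *: flux_deriv f a x qbar t).

Definition hfun a x b y (alpha : 'cV[R]_d) (xi : R) : 'cV[R]_d :=
  \sum_j (g (xi - x j) *: b j - (y j * derive1 (@g R) (xi - x j)) *: a j) + alpha.

Definition Dfun f a x qbar b y (alpha : 'cV[R]_d) (xi : R) : 'cV[R]_d :=
  Ffun f a x qbar xi - hfun a x b y alpha xi.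

Definition Zvec f a x qbar b y (alpha : 'cV[R]_d) (i : 'I_N) : 'cV[R]_(d + d) :=
  col_mx (Dfun f a x qbar b y alpha (x i)) (derive1 (Dfun f a x qbar b y alpha) (x i)).

(* x_{i+1} and x_{i-1} for the extension x_{i+mN} = x_i + m of the knots. *)
Definition knot_next x (i : 'I_N) : R := x (ordS i) + (i.+1 == N)%:R.
Definition knot_prev x (i : 'I_N) : R := x (ord_pred i) - (i == 0 :> nat)%:R.

Definition delta_p x (i : 'I_N) : R := `|knot_next x i - x i|.
Definition delta_m x (i : 'I_N) : R := `|knot_prev x i - x i|.

(* Acoef i is A_{i+1/2} and Bcoef i is B_{i+1/2}; hence A_{i-1/2} and B_{i-1/2}
   are their values at ord_pred i. *)
Definition Acoef f a x qbar (i : 'I_N) : 'cV[R]_d :=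
  let q := profile a x qbar in
  let G s := f (q (x i) + s *: (q (knot_next x i) - q (x i))) in
  (delta_p x i ^- 2) *: vint01 (fun s => (6 * s * (1 - s)) *: derive1n 2 G s).

Definition Bcoef f a x qbar (i : 'I_N) : 'cV[R]_d :=
  let q := profile a x qbar in
  (delta_p x i)^-1 *: (f (q (knot_next x i)) - f (q (x i))).

Definition rhs f a x qbar (i : 'I_N) : 'cV[R]_(d + d) :=
  let A := Acoef f a x qbar in
  let B := Bcoef f a x qbar in
  let i' := ord_pred i in
  col_mx (A i - A i')
         (- (B i - (delta_p x i / 2) *: A i) + (B i' + (delta_m x i / 2) *: A i')).

Definition mx2 (p11 p12 p21 p22 : R) : 'M[R]_(1 + 1) :=
  block_mx p11%:M p12%:M p21%:M p22%:M.

Fact mul2_addnn : ((1 + 1) * d = d + d)%N.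
Proof. by rewrite mul2n addnn. Qed.

(* The Kronecker product of P with the d x d identity. *)
Definition kron1 (P : 'M[R]_(1 + 1)) : 'M[R]_(d + d) :=
  castmx (mul2_addnn, mul2_addnn) (P *t (1%:M : 'M[R]_d)).

Definition Gdiag (la lx : R) a x (i : 'I_N) : 'M[R]_(d + d) :=
  let dp := delta_p x i in let dm := delta_m x i in
  kron1 (mx2 (12 * (dp ^- 3 + dm ^- 3)) (6 * (dp ^- 2 - dm ^- 2))
             (6 * (dp ^- 2 - dm ^- 2)) (4 * (dp^-1 + dm^-1)))
  + block_mx (la^-1)%:M 0 0 (lx^-1 *: (a i *m (a i)^T)).

Definition Gprev x (i : 'I_N) : 'M[R]_(d + d) :=
  let dm := delta_m x i in
  kron1 (mx2 (- 12 * dm ^- 3) (- 6 * dm ^- 2) (6 * dm ^- 2) (2 * dm^-1)).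

Definition Gnext x (i : 'I_N) : 'M[R]_(d + d) :=
  let dp := delta_p x i in
  kron1 (mx2 (- 12 * dp ^- 3) (6 * dp ^- 2) (- 6 * dp ^- 2) (2 * dp^-1)).

End Profile.

(* Main.v *)
From Pilot Require Import Defs.
From HB Require Import structures.
From mathcomp Require Import all_boot all_order all_algebra.
From mathcomp Require Import all_classical all_reals all_analysis.
From mathcomp Require Import mxtens measurable_realfun zify ring lra.

Set Implicit Arguments.
Unset Strict Implicit.
Unset Printing Implicit Defensive.

Import Order.TTheory GRing.Theory Num.Theory.
Import numFieldNormedType.Exports.

Local Open Scope classical_set_scope.
Local Open Scope ring_scope.

(* Testing the Lagrangian, a quadratic function of the velocities, along each
   coordinate direction says that the convolution of the residual r with phi is
   - alpha - la da_i at the knot x_i, and that the one with phi' determines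
   dx_i; up to sign and alpha these convolutions are D and D'.  As phi'' is 1
   minus the Dirac comb and r has mean zero, D'' = r: D and D' at the next knot
   are the Taylor polynomial at x_i plus the integrals of (x_(i+1) - t) r(t) and
   of r(t) over the piece in between.  Since the a_i (and the da_i) sum to zero,
   on each piece q is affine, and r is affine plus the derivative of f \o q.
   Eliminating the coefficients of these affine functions, whose jumps at x_i
   are - da_i for the slope and dx_i a_i for the value, leaves the three-term
   system; the integral of f \o q over a piece is absorbed in A by two
   integrations by parts. *)

(* all_algebra exports another frac. *)
Local Notation frac := Pilot.Defs.frac.

(** * Integrals of locally bounded measurable functions *)

(** The identity D'' = r cannot be used pointwise, because r contains phi' and the derivative of
    f(q), whose values at the knots are unspecified. Everything is extracted instead from an exact
    integral Taylor formula for convolutions with phi, which needs r only measurable, locally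
    bounded and periodic, and holds for steps in [0, 1]. It serves twice: to differentiate D, and to
    step from one knot to the next. The elimination closes by a count. On the two pieces adjacent to
    x_i the affine parts of r have four coefficients; the increments of D and D' over both pieces
    give four equations and the jumps at x_i two more, so two relations remain: the two block rows.
    Stationarity expresses the jumps through D(x_i) and D'(x_i), whence the terms with 1/la and 1/lx
    in the diagonal block. The mean of f(q) over a piece enters through the increment of D. The
    weight 6 s (1 - s) in A produces the same mean together with end values only. *)

Section LocallyBoundedMeasurable.
Context {R : realType}.
Implicit Types (h k F : R -> R) (a b c t : R).

(** A class stable under sums, products, translations and finite patching that tolerates arbitrary
    values at corners. Boundedness is only local because affine factors such as t - de also have to
    belong to it. *)
Definition nice h := measurable_fun [set: R] h /\
  forall A : R, exists K : R, forall t, `|t| <= A -> `|h t| <= K.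

Definition itg a b h : R := \int[lebesgue_measure]_(t in `[a, b]) h t.

Lemma nice_continuous h : continuous h -> nice h.
Proof.
move=> ch; split; first exact: continuous_measurable_fun.
move=> A.
have : bounded_set (h @` `[-A, A]).
  apply: compact_bounded; apply: continuous_compact; last exact: segment_compact.
  by apply: continuous_subspaceT.
move=> [M [_ HM]]; exists (M + 1) => t tA.
apply: (HM (M + 1)); first by rewrite ltrDl.
by exists t => //=; rewrite in_itv /= -ler_norml.
Qed.

Lemma nice_cst c : nice (fun=> c).
Proof. by apply: nice_continuous => t; exact: cvg_cst. Qed.

Lemma niceD h k : nice h -> nice k -> nice (fun t => h t + k t).
Proof.
move=> [mh bh] [mk bk]; split; first exact: measurable_funD.
move=> A; have [K HK] := bh A; have [L HL] := bk A; exists (K + L) => t tA.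
by rewrite (le_trans (ler_normD _ _)) // lerD ?HK ?HL.
Qed.

Lemma niceM h k : nice h -> nice k -> nice (fun t => h t * k t).
Proof.
move=> [mh bh] [mk bk]; split; first exact: measurable_funM.
move=> A; have [K HK] := bh A; have [L HL] := bk A; exists (K * L) => t tA.
by rewrite normrM ler_pM ?HK ?HL.
Qed.

Lemma niceZ c h : nice h -> nice (fun t => c * h t).
Proof. by move=> nh; apply: niceM => //; exact: nice_cst. Qed.

Lemma niceN h : nice h -> nice (fun t => - h t).
Proof. by move=> /(niceZ (-1)); under eq_fun do rewrite mulN1r. Qed.

Lemma niceB h k : nice h -> nice k -> nice (fun t => h t - k t).
Proof. by move=> nh /niceN; exact: niceD. Qed.

Lemma nice_sum (J : Type) (s : seq J) (P : pred J) (h : J -> R -> R) :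
  (forall j, nice (h j)) -> nice (fun t => \sum_(j <- s | P j) h j t).
Proof.
move=> nh; elim: s => [|j s IH].
  by under eq_fun do rewrite big_nil; exact: nice_cst.
under eq_fun do rewrite big_cons; case: (P j) => //; exact: niceD.
Qed.

Lemma nice_shift c h : nice h -> nice (fun t => h (t + c)).
Proof.
move=> [mh bh]; split.
  by apply: (measurableT_comp mh); apply: measurable_funD.
move=> A; have [K HK] := bh (A + `|c|); exists K => t tA.
by apply: HK; rewrite (le_trans (ler_normD _ _)) // lerD2r.
Qed.

Lemma nice_integrable a b h : nice h ->
  lebesgue_measure.-integrable `[a, b] (EFin \o h).
Proof.
move=> [mh bh]; apply: measurable_bounded_integrable => //.
- by rewrite /= lebesgue_measure_itv; case: ifP => _; rewrite ?ltry// -EFinD ltry.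
- exact: measurable_funTS.
have [K HK] := bh (`|a| + `|b|); exists K; split; first exact: num_real.
move=> M KM t /=; rewrite in_itv /= => /andP[at_ tb].
rewrite (le_trans (HK t _)) ?(ltW KM) //.
rewrite ler_norml; apply/andP; split.
  by have := ler_norm (- a); rewrite normrN; have := normr_ge0 b; lra.
by have := ler_norm b; have := normr_ge0 a; lra.
Qed.

Lemma itgD a b h k : nice h -> nice k ->
  itg a b (fun t => h t + k t) = itg a b h + itg a b k.
Proof. by move=> nh nk; apply: RintegralD => //; exact: nice_integrable. Qed.

Lemma itgZ a b c h : nice h -> itg a b (fun t => c * h t) = c * itg a b h.
Proof. by move=> nh; apply: RintegralZl => //; exact: nice_integrable. Qed.

Lemma itgN a b h : nice h -> itg a b (fun t => - h t) = - itg a b h.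
Proof.
by move=> nh; under [X in itg _ _ X]eq_fun do rewrite -mulN1r; rewrite itgZ // mulN1r.
Qed.

Lemma itgB a b h k : nice h -> nice k ->
  itg a b (fun t => h t - k t) = itg a b h - itg a b k.
Proof. by move=> nh nk; rewrite itgD ?itgN //; exact: niceN. Qed.

Lemma itg_sum a b (J : Type) (s : seq J) (P : pred J) (h : J -> R -> R) :
  (forall j, nice (h j)) ->
  itg a b (fun t => \sum_(j <- s | P j) h j t) = \sum_(j <- s | P j) itg a b (h j).
Proof.
move=> nh; elim: s => [|j s IH].
  under [X in itg _ _ X]eq_fun do rewrite big_nil.
  by rewrite big_nil /itg Rintegral_cst // mul0r.
under [X in itg _ _ X]eq_fun do rewrite big_cons.
rewrite big_cons; case: (P j) => //; rewrite itgD ?IH //; exact: nice_sum.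
Qed.

(** Endpoints are null sets. Corners are always placed at the ends of the interval, so that the
    unspecified derivatives there never have to be computed. *)
Lemma itg_ext a b h k : nice h -> nice k ->
  (forall t, a < t < b -> h t = k t) -> itg a b h = itg a b k.
Proof.
move=> nh nk hk; rewrite /itg.
have E l : nice l -> \int[lebesgue_measure]_(t in `]a, b[) l t =
                     \int[lebesgue_measure]_(t in `[a, b]) l t.
  move=> nl; have il := nice_integrable a b nl.
  have S1 : lebesgue_measure.-integrable `[a, b[ (EFin \o l).
    by apply: integrableS il => //; apply: subset_itvl; rewrite bnd_simp.
  have S2 : lebesgue_measure.-integrable `]a, b[ (EFin \o l).
    by apply: integrableS S1 => //; apply: subset_itvr; rewrite bnd_simp.
  by rewrite Rintegral_itv_obnd_cbnd // Rintegral_itv_bndo_bndc.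
rewrite -(E _ nh) -(E _ nk); apply: eq_Rintegral => t.
by rewrite inE /= in_itv /=; exact: hk.
Qed.

Lemma itg_split c a b h : nice h -> a <= c -> c <= b ->
  itg a b h = itg a c h + itg c b h.
Proof.
move=> nh ac cb; rewrite /itg.
have ih := nice_integrable a b nh.
have := @Rintegral_itvB R h (BLeft a) (BRight b) c ih.
rewrite !bnd_simp => /(_ ac cb).
rewrite Rintegral_itv_obnd_cbnd; first by move/eqP; rewrite subr_eq addrC => /eqP.
by apply: integrableS (nice_integrable c b nh) => //; apply: subset_itvr; rewrite bnd_simp.
Qed.

Lemma itg_point a h : itg a a h = 0.
Proof. by rewrite /itg set_itv1 Rintegral_set1. Qed.

Lemma itg_cst a b c : a <= b -> itg a b (fun=> c) = c * (b - a).
Proof.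
move=> ab; rewrite /itg Rintegral_cst //; move: (lebesgue_measure_itv `[a, b]) => /= -> /=; rewrite lte_fin.
case: ltP => //= ba; have -> : a = b by lra.
by rewrite subrr.
Qed.

Lemma itg_le a b K h : nice h -> a <= b ->
  (forall t, a <= t <= b -> `|h t| <= K) -> `|itg a b h| <= K * (b - a).
Proof.
move=> nh ab hK; rewrite -itg_cst //.
apply: (@le_trans _ _ (itg a b (fun t => `|h t|))).
  by apply: le_normr_Rintegral; [exact: measurable_itv|exact: nice_integrable].
rewrite /itg; apply: (@le_Rintegral _ _ _ lebesgue_measure `[a, b]%classic (fun t => `|h t|) (fun=> K)).
- exact: measurable_itv.
- exact: (integrable_norm (nice_integrable a b nh)).
- exact: (nice_integrable a b (nice_cst K)).
- by move=> t /=; rewrite in_itv /=; exact: hK.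
Qed.

Lemma itg_derive a b h F : a <= b -> continuous h ->
  (forall t, a <= t <= b -> is_derive t 1 F (h t)) -> itg a b h = F b - F a.
Proof.
rewrite le_eqVlt => /predU1P[<- _ _|ab ch Fh]; first by rewrite itg_point subrr.
have cF t : a <= t <= b -> {for t, continuous F}.
  by move=> /Fh[dF _]; apply: differentiable_continuous; apply/derivable1_diffP.
rewrite /itg /Rintegral (@continuous_FTC2 _ h F a b) //.
- exact: continuous_subspaceT.
- split.
  + by move=> t /[!in_itv]/= /andP[/ltW at_ /ltW tb]; have [] := Fh t; rewrite ?at_.
  + by apply: cvg_at_right_filter; apply: cF; rewrite lexx ltW.
  + by apply: cvg_at_left_filter; apply: cF; rewrite lexx ltW.
- move=> t /[!in_itv]/= /andP[/ltW at_ /ltW tb]; rewrite derive1E.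
  by have [|_ ->] := Fh t; rewrite ?at_.
Qed.

(** The base point c lies strictly to the left of the interval of interest: with c = -1 the
    primitive has a two-sided derivative at 0 as well. *)
Lemma primitive h c : continuous h ->
  exists F : R -> R, forall t, c < t -> is_derive t 1 F (h t).
Proof.
move=> ch; exists (fun t => itg c t h) => t ct.
have [] := @continuous_FTC1_closed R h c t (t + 1) _ (nice_integrable c (t + 1) (nice_continuous ch)) ct (ch t).
  by rewrite ltrDl.
by rewrite derive1E => dF Fh; apply: DeriveDef.
Qed.

Lemma lebesgue_measure_shift (c : R) (A : set R) : measurable A ->
  pushforward lebesgue_measure ((fun t => t + c) : _ -> measurableTypeR R) A =
  lebesgue_measure A.
Proof.
move=> mA; apply/esym/lebesgue_measure_unique => //=.
  exact: measurable_funD.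
move=> mc _ [[u v]] _ <-; rewrite /pushforward.
have -> : (fun t => t + c) @^-1` `]u, v] = `]u - c, v - c]%classic.
  by apply/seteqP; split => t /=; rewrite !in_itv /= ltrBlDr lerBrDr.
by rewrite !lebesgue_measure_itv /= !lte_fin ltrD2r -!EFinD opprD opprK addrACA addNr addr0.
Qed.

Lemma itg_trans c a b h : nice h ->
  itg a b (fun t => h (t + c)) = itg (a + c) (b + c) h.
Proof.
move=> nh; rewrite /itg /Rintegral; congr fine.
have mc : measurable_fun [set: R] ((fun t => t + c) : _ -> measurableTypeR R).
  exact: measurable_funD.
have pre : (fun t => t + c) @^-1` `[a + c, b + c] = `[a, b]%classic.
  by apply/seteqP; split => t /=; rewrite !in_itv /= !lerD2r.
transitivity (\int[pushforward lebesgue_measure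
    ((fun t => t + c)%R : _ -> measurableTypeR R)]_(t in `[(a + c)%R, (b + c)%R]) (h t)%:E)%E.
  rewrite integral_pushforward ?pre //.
  - by apply/measurable_EFinP; case: nh.
  - exact: (nice_integrable a b (nice_shift c nh)).
apply: eq_measure_integral => A mA _.
exact: lebesgue_measure_shift.
Qed.

End LocallyBoundedMeasurable.

(** * Periodic functions and the kernel phi *)

Section Periodic.
Context {R : realType}.
Implicit Types (h k r : R -> R) (c t u : R).

Definition per (V : Type) (h : R -> V) := forall t, h (t + 1) = h t.

Lemma per_nat (V : Type) (h : R -> V) (n : nat) t : per h -> h (t + n%:R) = h t.
Proof.
move=> ph; elim: n => [|n IH]; first by rewrite addr0.
by rewrite -natr1 addrA ph IH.
Qed.

Lemma per_int (V : Type) (h : R -> V) (m : int) t : per h -> h (t + m%:~R) = h t.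
Proof.
move=> ph; case: m => n; first exact: per_nat.
by rewrite NegzE mulrNz -(per_nat n.+1 (t - _) ph) subrK.
Qed.

Lemma per_frac (V : Type) (h : R -> V) t : per h -> h (frac t) = h t.
Proof. by move=> ph; rewrite /frac -mulrNz per_int. Qed.

Lemma per_shift (V : Type) (h : R -> V) c : per h -> per (fun t => h (t + c)).
Proof. by move=> ph t; rewrite addrAC ph. Qed.

Lemma perM h k : per h -> per k -> per (fun t => h t * k t).
Proof. by move=> ph pk t; rewrite ph pk. Qed.

Lemma per_derive1 (V : normedModType R) (h : R -> V) : per h -> per (derive1 h).
Proof.
move=> ph t; rewrite /derive1.
by under [X in X @ _]eq_fun do rewrite addrA !ph.
Qed.

Lemma frac_ge0 t : 0 <= frac t.
Proof. by rewrite /frac subr_ge0 floor_le. Qed.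

Lemma frac_lt1 t : frac t < 1.
Proof. by rewrite /frac ltrBlDl -[X in _ + X]/(1%:~R) -intrD floorD1_gt. Qed.

Lemma frac_id t : 0 <= t < 1 -> frac t = t.
Proof.
move=> t01; rewrite /frac (_ : Num.floor t = 0) ?subr0 //.
by apply: floor_def; rewrite add0r.
Qed.

Lemma frac_per : per (@frac R).
Proof.
by move=> t; rewrite /frac floorDrz ?rpred1 // floor1 intrD opprD addrACA subrr addr0.
Qed.

Lemma measurable_frac : measurable_fun [set: R] (@frac R).
Proof.
apply: measurable_funB => //; apply: nondecreasing_measurable => // s t st.
by rewrite ler_int; exact: le_floor.
Qed.

Lemma nice_per h K : measurable_fun [set: R] h -> per h ->
  (forall t, 0 <= t < 1 -> `|h t| <= K) -> nice h.
Proof.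
move=> mh ph hK; split=> // A; exists K => t _.
by rewrite -(per_frac t ph) hK // frac_ge0 frac_lt1.
Qed.

Lemma per_bounded h : nice h -> per h -> exists2 K, 0 <= K & forall t, `|h t| <= K.
Proof.
move=> [_ /(_ 1)[K hK]] ph; exists (`|K|) => // t.
rewrite -(per_frac t ph) (le_trans _ (ler_norm K)) // hK //.
by rewrite ger0_norm ?frac_ge0 // ltW ?frac_lt1.
Qed.

Lemma itg_per c h : nice h -> per h -> itg 0 1 (fun t => h (t + c)) = itg 0 1 h.
Proof.
move=> nh ph.
(* With the shift reduced modulo 1, the window from c to 1 + c is cut only at 1, and its part beyond
   1 is a translate of [0, c]. *)
have -> : (fun t => h (t + c)) = (fun t => h (t + frac c)).
  by apply/funext => t; rewrite /frac addrA -mulrNz per_int.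
have c0 := frac_ge0 c; have c1 := ltW (frac_lt1 c); move: (frac c) c0 c1 => {}c c0 c1.
rewrite itg_trans // (@itg_split _ 1) ?add0r ?lerDl //.
rewrite [RHS](@itg_split _ c) // [RHS]addrC; congr +%R.
rewrite -{1}[1]add0r [1 + c]addrC -itg_trans //; congr itg.
by apply/funext => t.
Qed.

(** Half the second Bernoulli polynomial. It satisfies bern (u + 1) = bern u + u and has derivative
    u - 1/2. *)
Definition bern u := u ^+ 2 / 2 - u / 2 + 12^-1.

Lemma phi_per : per (@phi R).
Proof. by move=> t; rewrite /phi frac_per. Qed.

(** The right end is included because [bern] has the same value at 0 and at 1. *)
Lemma phi_itv u : 0 <= u <= 1 -> phi u = bern u.
Proof.
move=> /andP[u0]; rewrite le_eqVlt => /predU1P[->|u1].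
  by rewrite -[1]add0r phi_per /phi frac_id ?lexx ?ltr01 // /bern; field.
by rewrite /phi frac_id ?u0.
Qed.

Lemma continuous_bern : continuous bern.
Proof.
move=> u; rewrite /bern.
by apply: cvgD; [apply: cvgB|exact: cvg_cst]; apply: cvgM; (try exact: cvg_cst); try exact: cvg_id; exact: exprn_continuous.
Qed.

Lemma nice_bern : nice bern.
Proof. exact: nice_continuous continuous_bern. Qed.

Lemma nice_id : nice (@id R).
Proof. by apply: nice_continuous => t; exact: cvg_id. Qed.

Lemma nice_phi : nice (@phi R).
Proof.
have [mb /(_ 1)[K hK]] := nice_bern.
apply: (@nice_per _ K); [|exact: phi_per|].
  have -> : @phi R = bern \o @frac R by [].
  by apply: measurableT_comp => //; exact: measurable_frac.
move=> t /andP[t0 t1]; rewrite phi_itv; last by rewrite t0 ltW.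
apply: hK.
by rewrite ger0_norm // ltW.
Qed.

Definition dphi : R -> R := derive1 (@phi R).

Lemma dphi_per : per dphi.
Proof. exact: per_derive1 phi_per. Qed.

Lemma is_derive_bern u : is_derive u 1 bern (u - 2^-1).
Proof.
rewrite (_ : bern = fun u => 2^-1 *: (u * u) - 2^-1 *: u + 12^-1); last first.
  by apply/funext => v; rewrite /bern /GRing.scale /=; field.
by apply: is_derive_eq; rewrite scaler0 /GRing.scale /=; field.
Qed.

Lemma dphi_itv u : 0 < u < 1 -> dphi u = u - 2^-1.
Proof.
move=> u01; rewrite /dphi derive1E.
have <- : 'D_1 bern u = u - 2^-1 by have [_ ->] := is_derive_bern u.
apply: near_eq_derive.
near=> t; apply: phi_itv.
have : t \in `]0, 1[ by near: t; exact: near_in_itvoo.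
by rewrite in_itv /= => /andP[/ltW -> /ltW ->].
Unshelve. all: by end_near. Qed.

Lemma nice_dphi : nice dphi.
Proof.
have E : dphi = fun t => (frac t - 2^-1) + (dphi 0 + 2^-1) * \1_[set 0] (frac t).
  apply/funext => t; rewrite -(per_frac t dphi_per) indicE.
  have [->|t0] := eqVneq (frac t) 0; first by rewrite mem_set //=; lra.
  rewrite memNset; last by move=> /= t0'; rewrite t0' eqxx in t0.
  by rewrite mulr0 addr0 dphi_itv // lt_neqAle eq_sym t0 frac_ge0 frac_lt1.
apply: (@nice_per _ (1 + `|dphi 0 + 2^-1|)); [|exact: dphi_per|].
  rewrite E; apply: measurable_funD.
    by apply: measurable_funB => //; exact: measurable_frac.
  apply: measurable_funM => //; apply: measurableT_comp; last exact: measurable_frac.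
  exact: measurable_indic.
move=> t _; rewrite {1}E (le_trans (ler_normD _ _)) // lerD //.
  by have := frac_ge0 t; have := frac_lt1 t; rewrite ler_norml => ? ?; apply/andP; split; lra.
by rewrite normrM indicE ler_piMr //; case: (_ \in _); rewrite ?normr1 ?normr0.
Qed.

End Periodic.

(** * Convolution with the kernel *)

#[local] Hint Resolve nice_phi nice_dphi nice_bern nice_id nice_cst phi_per dphi_per : core.

Section Convolution.
Context {R : realType}.
Implicit Types (h k r : R -> R) (c t u xi de : R).

Definition conv_phi r xi := itg 0 1 (fun t => r t * phi (t - xi)).
Definition conv_dphi r xi := itg 0 1 (fun t => r t * dphi (t - xi)).

Lemma conv_phi_per r : per (conv_phi r).
Proof.
move=> xi; congr (itg _ _ _); apply/funext => t.
by rewrite -(phi_per (t - (xi + 1))) opprD addrA subrK.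
Qed.

Lemma conv_dphi_per r : per (conv_dphi r).
Proof.
move=> xi; congr (itg _ _ _); apply/funext => t.
by rewrite -(dphi_per (t - (xi + 1))) opprD addrA subrK.
Qed.

Lemma nice_conv r k xi : nice r -> nice k -> nice (fun t => r t * k (t - xi)).
Proof. by move=> nr nk; apply: niceM => //; exact: nice_shift. Qed.

Lemma conv_shift r k xi de : nice r -> nice k -> per r -> per k ->
  itg 0 1 (fun t => r t * k (t - (xi + de))) =
  itg 0 1 (fun t => r (t + xi) * k (t - de)).
Proof.
move=> nr nk pr pk.
rewrite -(@itg_per _ xi (fun t => r t * k (t - (xi + de)))); first last.
- by apply: perM => //; exact: per_shift.
- exact: nice_conv.
by congr itg; apply/funext => t; rewrite opprD addrA addrK.
Qed.

(** For 0 < t < de the argument t - de lies in (-1, 0), where the periodic k equals l shifted by one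
    period. Hence k may be replaced by the polynomial l everywhere, at the price of the defect j on
    [0, de]. *)
Lemma conv_split r k l (j : R -> R) xi de : nice r -> nice k -> nice l -> nice j ->
  per k -> 0 <= de <= 1 ->
  (forall u, 0 < u < 1 -> k u = l u) -> (forall u, l (u + 1) = l u + j u) ->
  itg 0 1 (fun t => r (t + xi) * k (t - de)) =
  itg 0 1 (fun t => r (t + xi) * l (t - de)) + itg 0 de (fun t => r (t + xi) * j (t - de)).
Proof.
move=> nr nk nl nj pk /andP[d0 d1] kl lj.
have nrs : nice (fun t => r (t + xi)) by exact: nice_shift.
have nkd := nice_conv de nrs nk; have nld := nice_conv de nrs nl.
have njd := nice_conv de nrs nj.
rewrite (itg_split nkd d0 d1) (itg_split nld d0 d1) addrAC; congr (_ + _); last first.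
  apply: itg_ext => // t td; rewrite kl //; lra.
rewrite -itgD //; apply: itg_ext => //; first exact: niceD.
move=> t td; rewrite -pk kl; last lra.
by rewrite lj mulrDr.
Qed.

(** The first three terms come from the exact expansion of the quadratic bern (t - de) at t; the
    last one from the defect bern (u + 1) - bern u = u. These are the contributions of 1 and of the
    Dirac comb in phi''. *)
Lemma conv_phi_taylor r xi de : nice r -> per r -> 0 <= de <= 1 ->
  conv_phi r (xi + de) = conv_phi r xi - de * conv_dphi r xi
    + de ^+ 2 / 2 * itg 0 1 r + itg 0 de (fun t => r (t + xi) * (t - de)).
Proof.
move=> nr pr d01; have nrs : nice (fun t => r (t + xi)) by exact: nice_shift.
have z01 : 0 <= (0 : R) <= 1 by rewrite lexx ler01.
rewrite /conv_phi /conv_dphi -[in RHS](addr0 xi) !conv_shift //.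
rewrite (@conv_split _ _ (@bern R) id) //; last 2 first.
- by move=> u /andP[u0 u1]; rewrite phi_itv // !ltW.
- by move=> u; rewrite /bern; field.
rewrite addr0; congr (_ + _).
rewrite [X in _ = X - _ + _](_ : _ = itg 0 1 (fun t => r (t + xi) * bern t)); last first.
  apply: itg_ext; [exact: nice_conv nrs nice_phi|exact: niceM nrs nice_bern|].
  by move=> t t01; rewrite subr0 phi_itv //; lra.
rewrite [X in _ - _ * X](_ : _ = itg 0 1 (fun t => r (t + xi) * (t - 2^-1))); last first.
  apply: itg_ext; [exact: nice_conv nrs nice_dphi| |].
    by apply: niceM => //; apply: niceB; [exact: nice_id|exact: nice_cst].
  by move=> t t01; rewrite subr0 dphi_itv //; lra.
rewrite -(itg_per xi nr pr) -!itgZ //; last first.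
  by apply: niceM => //; apply: niceB; [exact: nice_id|exact: nice_cst].
rewrite -itgB; first last.
- by apply: niceZ; apply: niceM => //; apply: niceB; [exact: nice_id|exact: nice_cst].
- exact: niceM nrs nice_bern.
rewrite -itgD; first last.
- exact: niceZ.
- apply: niceB; first exact: niceM nrs nice_bern.
  by apply: niceZ; apply: niceM => //; apply: niceB; [exact: nice_id|exact: nice_cst].
by congr itg; apply/funext => t; rewrite /bern; field.
Qed.

Lemma conv_dphi_taylor r xi de : nice r -> per r -> 0 <= de <= 1 ->
  conv_dphi r (xi + de) = conv_dphi r xi - de * itg 0 1 r
    + itg 0 de (fun t => r (t + xi)).
Proof.
move=> nr pr d01; have nrs : nice (fun t => r (t + xi)) by exact: nice_shift.
have nh : nice (fun t : R => t - 2^-1) by apply: niceB; [exact: nice_id|exact: nice_cst].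
rewrite /conv_dphi -[in RHS](addr0 xi) !conv_shift //.
rewrite (@conv_split _ _ (fun t => t - 2^-1) (fun=> 1)) //; last 2 first.
- by move=> u u01; rewrite dphi_itv.
- by move=> u; rewrite addrAC.
rewrite addr0; congr (_ + _); last by congr itg; apply/funext => t; rewrite mulr1.
rewrite [X in _ = X - _](_ : _ = itg 0 1 (fun t => r (t + xi) * (t - 2^-1))); last first.
  apply: itg_ext; [exact: nice_conv nrs nice_dphi|exact: niceM|].
  by move=> t t01; rewrite subr0 dphi_itv //; lra.
rewrite -(itg_per xi nr pr) -!itgZ // -itgB; [|exact: niceM|exact: niceZ].
by congr itg; apply/funext => t; field.
Qed.

Lemma is_derive_quadratic_error (F : R -> R) xi L C :
  (forall de, `|de| <= 1 -> `|F (xi + de) - F xi - de * L| <= C * de ^+ 2) ->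
  is_derive xi 1 F L.
Proof.
move=> FL.
have lim0 : (fun de : R => de^-1 *: ((F \o shift xi) (de *: 1) - F xi)) @ 0^' --> L.
  apply/cvgrPdist_le => e e0.
  have C0 : 0 <= C.
    by have := FL 1; rewrite normr1 expr1n mulr1 => /(_ (lexx _)); exact: le_trans.
  near=> de.
  have dn0 : de != 0 by near: de; exact: nbhs_dnbhs_neq.
  have d1 : `|de| <= 1 by near: de; exact: dnbhs0_le.
  have de_e : `|de| <= e / (C + 1) by near: de; apply: dnbhs0_le; rewrite divr_gt0 //; lra.
  rewrite /= /GRing.scale /= mulr1 [de + _]addrC.
  rewrite (_ : L - _ = - de^-1 * (F (xi + de) - F xi - de * L)); last by field.
  rewrite normrM normrN normfV ler_pdivrMl ?normr_gt0 //.
  apply: le_trans (FL _ d1) _; rewrite -real_normK ?num_real // expr2 mulrCA.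
  rewrite ler_wpM2l //; apply: le_trans (_ : C * (e / (C + 1)) <= _).
    by rewrite ler_wpM2l.
  by rewrite mulrA ler_pdivrMr; [rewrite mulrC ler_wpM2l ?ltW //; lra|lra].
apply: DeriveDef; first by apply/cvg_ex; exists L.
exact: (cvg_lim _ lim0).
Unshelve. all: by end_near. Qed.

(** The Taylor formula gives a quadratic remainder for any bounded r, without continuity, but only
    for forward steps. A backward step is the forward step from xi + de, with [conv_dphi] moved back
    to xi by its Lipschitz bound; the two errors, each at most 2 K de^2, add up to 4 K de^2. *)
Lemma is_derive_conv_phi r xi : nice r -> per r ->
  is_derive xi 1 (conv_phi r) (- conv_dphi r xi).
Proof.
move=> nr pr; have [K K0 hK] := per_bounded nr pr.
have rK : `|itg 0 1 r| <= K.
  have := @itg_le _ 0 1 K r nr ler01; rewrite subr0 mulr1; apply => t _; exact: hK.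
have B1 x de : 0 <= de <= 1 ->
    `|conv_phi r (x + de) - conv_phi r x + de * conv_dphi r x| <= 2 * K * de ^+ 2.
  move=> /andP[d0 d1]; rewrite conv_phi_taylor ?d0 //.
  rewrite [X in `|X|](_ : _ = de ^+ 2 / 2 * itg 0 1 r + itg 0 de (fun t => r (t + x) * (t - de))); last by ring.
  have : `|itg 0 de (fun t => r (t + x) * (t - de))| <= K * de * (de - 0).
    apply: itg_le => //.
      apply: niceM; first exact: nice_shift.
      by apply: niceB; [exact: nice_id|exact: nice_cst].
    move=> t /andP[t0 td]; rewrite normrM ler_pM //.
    by rewrite distrC ger0_norm; lra.
  rewrite subr0 => H; apply: (le_trans (ler_normD _ _)).
  rewrite normrM (ger0_norm (_ : 0 <= de ^+ 2 / 2)); last by rewrite divr_ge0 ?sqr_ge0.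
  have := @ler_wpM2l _ (de ^+ 2 / 2) _ _ _ rK; rewrite divr_ge0 ?sqr_ge0 // => /(_ isT) H2.
  have : 0 <= K * de ^+ 2 by rewrite mulr_ge0 ?sqr_ge0.
  by rewrite expr2 in H2 *; nra.
have B2 x de : 0 <= de <= 1 -> `|conv_dphi r (x + de) - conv_dphi r x| <= 2 * K * de.
  move=> /andP[d0 d1]; rewrite conv_dphi_taylor ?d0 //.
  rewrite [X in `|X|](_ : _ = - (de * itg 0 1 r) + itg 0 de (fun t => r (t + x))); last by ring.
  have : `|itg 0 de (fun t => r (t + x))| <= K * (de - 0).
    by apply: itg_le => //; exact: nice_shift.
  rewrite subr0 => H; apply: (le_trans (ler_normD _ _)).
  rewrite normrN normrM (ger0_norm d0).
  have := @ler_wpM2l _ de _ _ _ rK; rewrite d0 => /(_ isT) H2.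
  by lra.
apply: (@is_derive_quadratic_error _ _ _ (4 * K)) => de d1.
have [d0|d0] := leP 0 de.
  rewrite ger0_norm // in d1.
  have := B1 xi de; rewrite d0 d1 => /(_ isT).
  rewrite mulrN opprK => H; apply: (le_trans H).
  by rewrite ler_wpM2r ?sqr_ge0 //; lra.
rewrite ltr0_norm // in d1.
have nd : 0 <= - de <= 1 by lra.
have := B1 (xi + de) (- de) nd; have := B2 (xi + de) (- de) nd; rewrite addrK => H2 H1.
move: H1 H2; move: (conv_phi r xi) (conv_phi r (xi + de)) (conv_dphi r xi) (conv_dphi r (xi + de)) => p q m n H1 H2.
rewrite (_ : q - p - _ = - (p - q + - de * n) - de * (n - m)); last by ring.
apply: (le_trans (ler_normB _ _)); rewrite normrN.
rewrite [X in _ + X]normrM (ltr0_norm d0) [X in _ + _ * X]distrC.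
have := @ler_wpM2l _ (- de) _ _ _ H2; rewrite (_ : 0 <= - de); last lra.
by move=> /(_ isT) => H3; rewrite sqrrN expr2 in H1; rewrite expr2; lra.
Qed.

End Convolution.

(** * First variation of the objective *)

Section Autocorrelation.
Context {R : realType}.
Implicit Types (k : R -> R) (xi c : R).

Lemma g_conv xi : g xi = conv_phi (@phi R) xi.
Proof.
rewrite /conv_phi -[in RHS](addr0 xi) conv_shift //.
by congr itg; apply/funext => t; rewrite subr0 [xi + t]addrC.
Qed.

Lemma conv_phi_shift k c xi : nice k -> per k ->
  itg 0 1 (fun t => k (t - c) * phi (t - xi)) = conv_phi k (xi - c).
Proof.
move=> nk pk; rewrite -[in LHS](subrK c xi) addrC conv_shift //.
- by rewrite /conv_phi; congr itg; apply/funext => t; rewrite addrK.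
- exact: nice_shift.
- exact: per_shift.
Qed.

(** Differentiating [conv_phi] puts the derivative on the kernel, whereas [hfun] has to be read as a
    convolution of [phi] with the velocity, whose terms contain [dphi]. Writing g through its
    evenness moves the derivative to the other factor. *)
Lemma is_derive_g xi : is_derive xi 1 (@g R) (conv_phi dphi xi).
Proof.
have -> : @g R = conv_phi (@phi R) \o -%R.
  apply/funext => t; rewrite g_conv /= /conv_phi.
  rewrite -(@itg_per _ t (fun s => phi s * phi (s - t))).
  - by congr itg; apply/funext => s; rewrite addrK opprK mulrC.
  - exact: nice_conv.
  - by apply: perM => //; exact: per_shift.
have E : conv_phi dphi xi = - conv_dphi (@phi R) (- xi) * -1.
  rewrite mulrN1 opprK /conv_phi /conv_dphi.
  rewrite -(@itg_per _ xi (fun s => dphi s * phi (s - xi))).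
  - by congr itg; apply/funext => s; rewrite addrK opprK mulrC.
  - exact: nice_conv.
  - by apply: perM => //; exact: per_shift.
rewrite E; apply: is_derive1_comp; exact: is_derive_conv_phi.
Qed.

Lemma derive1_g xi : derive1 (@g R) xi = conv_phi dphi xi.
Proof. by rewrite derive1E; have [_ ->] := is_derive_g xi. Qed.

End Autocorrelation.

Lemma sum_delta (R : pzRingType) (I : finType) (i : I) (F : I -> R) :
  \sum_j (j == i)%:R * F j = F i.
Proof.
rewrite (bigD1 i) //= big1 ?eqxx ?mul1r ?addr0 // => j /negbTE ->.
by rewrite mul0r.
Qed.

Lemma sum_delta_mx (R : comNzRingType) (d : nat) (k : 'I_d) (c : R) (F : 'I_d -> R) :
  \sum_l (c *: delta_mx k 0 : 'cV[R]_d) l 0 * F l = c * F k.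
Proof.
rewrite -[F k](sum_delta k F) mulr_sumr; apply: eq_bigr => l _.
by rewrite !mxE eqxx andbT mulrA.
Qed.

Section FirstVariation.
Context {R : realType} {d N : nat} (f : 'cV[R]_d -> 'cV[R]_d) (la lx : R).
Context (a : 'I_N -> 'cV[R]_d) (x : 'I_N -> R) (qbar : 'cV[R]_d).
Context (nice_flux : forall k, nice (fun t => flux_deriv f a x qbar t k 0)).
Implicit Types (b : 'I_N -> 'cV[R]_d) (y : 'I_N -> R) (k : 'I_d) (s t xi : R).

Let res b y k t := residual f a x qbar b y t k 0.

Definition velocity b y k t :=
  \sum_i (b i k 0 * phi (t - x i) - y i * a i k 0 * dphi (t - x i)).

Lemma residualE b y k t :
  residual f a x qbar b y t k 0 = velocity b y k t + flux_deriv f a x qbar t k 0.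
Proof.
rewrite mxE summxE; congr (_ + _); apply: eq_bigr => i _.
by rewrite !mxE -/(dphi (t - x i)) mulrC; congr (_ - _); ring.
Qed.

Lemma nice_velocity_term (u v c : R) : nice (fun t => u * phi (t - c) - v * dphi (t - c)).
Proof. by apply: niceB; apply: niceZ; exact: nice_shift. Qed.

Lemma nice_velocity b y k : nice (velocity b y k).
Proof. by apply: nice_sum => i; exact: nice_velocity_term. Qed.

Lemma nice_residual b y k : nice (res b y k).
Proof.
rewrite (_ : res b y k = fun t => velocity b y k t + flux_deriv f a x qbar t k 0).
  by apply: niceD => //; exact: nice_velocity.
by apply/funext => t; exact: residualE.
Qed.

Lemma profile_per : per (profile a x qbar).
Proof.
move=> t; rewrite /profile; congr (_ + _); apply: eq_bigr => i _.
by rewrite addrAC phi_per.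
Qed.

Lemma flux_per : per (flux_deriv f a x qbar).
Proof. by apply: per_derive1 => t /=; rewrite profile_per. Qed.

Lemma velocity_per b y k : per (velocity b y k).
Proof.
by move=> t; apply: eq_bigr => i _; rewrite addrAC phi_per dphi_per.
Qed.

Lemma residual_per b y k : per (res b y k).
Proof.
move=> t.
apply: (etrans (residualE b y k (t + 1))).
apply: (etrans _ (esym (residualE b y k t))).
rewrite (velocity_per b y k t).
by rewrite (flux_per t).
Qed.

Lemma itg_mul_velocity r b y k : nice r ->
  itg 0 1 (fun t => r t * velocity b y k t) =
  \sum_i (b i k 0 * conv_phi r (x i) - y i * a i k 0 * conv_dphi r (x i)).
Proof.
move=> nr; under [X in itg _ _ X]eq_fun do rewrite mulr_sumr.
rewrite itg_sum; last by move=> i; apply: niceM => //; exact: nice_velocity_term.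
apply: eq_bigr => i _; rewrite /conv_phi /conv_dphi -!itgZ -?itgB; try exact: nice_conv.
- by congr itg; apply/funext => t; ring.
- by apply: niceZ; exact: nice_conv.
- by apply: niceZ; exact: nice_conv.
Qed.

(** Halves of the partial derivatives of the objective. The common factor 2 is kept outside, where
    it matches the multiplier written as twice a vector. *)
Definition grad_b b y i k := conv_phi (res b y k) (x i) + la * b i k 0.
Definition grad_y b y i := lx * y i - \sum_k a i k 0 * conv_dphi (res b y k) (x i).
Definition first_variation b y b' y' :=
  \sum_i \sum_k b' i k 0 * grad_b b y i k + \sum_i y' i * grad_y b y i.

Lemma objective_line b y b' y' : exists c, forall s,
  objective f la lx a x qbar (fun i => b i + s *: b' i) (fun i => y i + s * y' i) =
  objective f la lx a x qbar b y + s * (2 * first_variation b y b' y') + s ^+ 2 * c.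
Proof.
exists (\sum_k itg 0 1 (fun t => velocity b' y' k t * velocity b' y' k t)
  + la * \sum_i dotv (b' i) (b' i) + lx * \sum_i y' i ^+ 2) => s.
have resE k t : residual f a x qbar (fun i => b i + s *: b' i) (fun i => y i + s * y' i) t k 0
    = res b y k t + s * velocity b' y' k t.
  rewrite /res !residualE addrAC; congr (_ + _).
  rewrite /velocity mulr_sumr -big_split; apply: eq_bigr => i _ /=.
  by rewrite !mxE; ring.
have nr k := nice_residual b y k; have nv k := nice_velocity b' y' k.
have sq b1 y1 : \int[lebesgue_measure]_(t in `[0, 1])
     dotv (residual f a x qbar b1 y1 t) (residual f a x qbar b1 y1 t)
   = \sum_k itg 0 1 (fun t => residual f a x qbar b1 y1 t k 0 * residual f a x qbar b1 y1 t k 0).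
  by rewrite -itg_sum // => k; apply: niceM; exact: nice_residual.
rewrite /objective !sq.
have E1 : \sum_k itg 0 1 (fun t => residual f a x qbar (fun i => b i + s *: b' i) (fun i => y i + s * y' i) t k 0 * residual f a x qbar (fun i => b i + s *: b' i) (fun i => y i + s * y' i) t k 0)
  = \sum_k itg 0 1 (fun t => res b y k t * res b y k t)
    + s * (2 * \sum_k itg 0 1 (fun t => res b y k t * velocity b' y' k t))
    + s ^+ 2 * \sum_k itg 0 1 (fun t => velocity b' y' k t * velocity b' y' k t).
  rewrite !mulr_sumr -!big_split /=; apply: eq_bigr => k _.
  rewrite -!itgZ -?itgD; try by do ?[apply: niceD|apply: niceZ|apply: niceM].
  by congr itg; apply/funext => t; rewrite resE; ring.
have E2 : \sum_i dotv (b i + s *: b' i) (b i + s *: b' i) = \sum_i dotv (b i) (b i)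
    + s * (2 * \sum_i dotv (b i) (b' i)) + s ^+ 2 * \sum_i dotv (b' i) (b' i).
  rewrite !mulr_sumr -!big_split /=; apply: eq_bigr => i _.
  rewrite /dotv !mulr_sumr -!big_split /=; apply: eq_bigr => k _.
  by rewrite !mxE; ring.
have E3 : \sum_i (y i + s * y' i) ^+ 2 = \sum_i y i ^+ 2
    + s * (2 * \sum_i y i * y' i) + s ^+ 2 * \sum_i y' i ^+ 2.
  by rewrite !mulr_sumr -!big_split /=; apply: eq_bigr => i _; ring.
have E4 : first_variation b y b' y' =
    \sum_k itg 0 1 (fun t => res b y k t * velocity b' y' k t)
    + la * \sum_i dotv (b i) (b' i) + lx * \sum_i y i * y' i.
  under eq_bigr do rewrite itg_mul_velocity //.
  rewrite exchange_big !mulr_sumr -!big_split /= /first_variation -big_split /=.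
  apply: eq_bigr => i _; rewrite /dotv /grad_y mulrBr !mulr_sumr.
  rewrite sumrB [X in X + _ = _](_ : _ = \sum_k b' i k 0 * conv_phi (res b y k) (x i)
     + \sum_k la * (b i k 0 * b' i k 0)); last first.
    by rewrite -big_split; apply: eq_bigr => k _; rewrite /grad_b /=; ring.
  rewrite [X in _ + (_ - X) = _](_ : _ =
     \sum_k y' i * a i k 0 * conv_dphi (res b y k) (x i)); last first.
    by apply: eq_bigr => k _; ring.
  ring.
by rewrite E1 E2 E3 E4; ring.
Qed.

Lemma is_derive_quadratic (c0 c1 c2 : R) : is_derive (0 : R) (1 : R) (fun s : R => c0 + s * c1 + s ^+ 2 * c2) c1.
Proof.
apply: (@is_derive_quadratic_error _ _ _ _ `|c2|) => s _.
rewrite !add0r (_ : _ - _ = c2 * s ^+ 2); last by ring.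
by rewrite normrM [X in _ * X]ger0_norm ?sqr_ge0.
Qed.

Lemma is_multiplierE b y (mu : 'cV[R]_d) :
  is_multiplier f la lx a x qbar b y (2 *: mu) <->
  (forall i k, grad_b b y i k + mu k 0 = 0) /\ (forall i, grad_y b y i = 0).
Proof.
have lag b' y' : exists c0 c2, forall s,
    lagrangian f la lx a x qbar (2 *: mu) (fun i => b i + s *: b' i) (fun i => y i + s * y' i) =
    c0 + s * (2 * (\sum_i \sum_k b' i k 0 * (grad_b b y i k + mu k 0) + \sum_i y' i * grad_y b y i))
    + s ^+ 2 * c2.
  have [c oc] := objective_line b y b' y'.
  exists (objective f la lx a x qbar b y + dotv (2 *: mu) (\sum_i b i)), c => s.
  rewrite /lagrangian oc /first_variation.
  have -> : dotv (2 *: mu) (\sum_i (b i + s *: b' i)) =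
      dotv (2 *: mu) (\sum_i b i) + s * (2 * \sum_i \sum_k b' i k 0 * mu k 0).
    rewrite exchange_big /dotv !mulr_sumr -big_split; apply: eq_bigr => k _ /=.
    rewrite !summxE !mulr_sumr -big_split; apply: eq_bigr => i _ /=.
    by rewrite !mxE; ring.
  have -> : \sum_i \sum_k b' i k 0 * (grad_b b y i k + mu k 0) =
      \sum_i \sum_k b' i k 0 * grad_b b y i k + \sum_i \sum_k b' i k 0 * mu k 0.
    rewrite -big_split; apply: eq_bigr => i _ /=; rewrite -big_split.
    by apply: eq_bigr => k _; rewrite mulrDr.
  by ring.
split=> [mult|[gb gy] b' y']; last first.
  have [c0 [c2 lagE]] := lag b' y'.
  under eq_fun do rewrite lagE.
  rewrite !big1 ?addr0 ?mulr0; [exact: is_derive_quadratic| |].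
  - by move=> i _; rewrite gy mulr0.
  - by move=> i _; rewrite big1 // => k _; rewrite gb mulr0.
have fv b' y' : \sum_i \sum_k b' i k 0 * (grad_b b y i k + mu k 0) + \sum_i y' i * grad_y b y i = 0.
  have [c0 [c2 lagE]] := lag b' y'.
  set v := _ + _ in lagE *.
  have [_ D1] : is_derive (0 : R) (1 : R) (fun s : R => c0 + s * (2 * v) + s ^+ 2 * c2) 0.
    by have := mult b' y'; under eq_fun do rewrite lagE.
  have [_ D2] := is_derive_quadratic c0 (2 * v) c2.
  have /eqP := etrans (esym D2) D1; by rewrite mulf_eq0 pnatr_eq0 /= => /eqP.
split=> [i k|i].
  have := fv (fun j => (j == i)%:R *: delta_mx k 0) (fun=> 0).
  rewrite [X in _ + X]big1 ?addr0; last by move=> j _; rewrite mul0r.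
  under eq_bigr do rewrite sum_delta_mx.
  by rewrite (sum_delta i (fun j => grad_b b y j k + mu k 0)).
have := fv (fun=> 0) (fun j => (j == i)%:R).
rewrite big1 ?add0r; last by move=> j _; rewrite big1 // => k _; rewrite mxE mul0r.
by rewrite sum_delta.
Qed.

Lemma minimizer_first_variation b y b' y' :
  is_constrained_minimizer f la lx a x qbar b y -> \sum_i b' i = 0 ->
  first_variation b y b' y' = 0.
Proof.
move=> [sb min] sb'; have [c oc] := objective_line b y b' y'.
set v := first_variation _ _ _ _ in oc *.
have ge0 s : 0 <= s * (2 * v) + s ^+ 2 * c.
  have := min (fun i => b i + s *: b' i) (fun i => y i + s * y' i).
  rewrite oc -addrA lerDl; apply.
  by rewrite big_split /= -scaler_sumr sb sb' scaler0 addr0.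
clear oc min; have C0 : 0 < `|c| + 1 by have := normr_ge0 c; lra.
(* A step small enough for the linear term to win: the value becomes a square times c - 2 (|c| + 1),
   which is negative whatever the sign of c. *)
have := ge0 (- v / (`|c| + 1)).
have -> : - v / (`|c| + 1) * (2 * v) + (- v / (`|c| + 1)) ^+ 2 * c =
    (v / (`|c| + 1)) ^+ 2 * (c - 2 * (`|c| + 1)) by field; rewrite gt_eqF.
rewrite nmulr_lge0; last by have := ler_norm c; have := normr_ge0 c; lra.
move=> H; have /eqP := le_anti (introT andP (conj H (sqr_ge0 _))).
by rewrite sqrf_eq0 mulf_eq0 invr_eq0 (gt_eqF C0) orbF => /eqP.
Qed.

Lemma multiplier_exists b y : (0 < N)%N ->
  is_constrained_minimizer f la lx a x qbar b y ->
  exists! mu : 'cV[R]_d, is_multiplier f la lx a x qbar b y (2 *: mu).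
Proof.
move=> N0 min; pose i0 := Ordinal N0.
exists (\col_k - grad_b b y i0 k); split; last first.
  move=> mu /is_multiplierE[gb _]; apply/colP => k; rewrite mxE.
  by apply/eqP; rewrite -subr_eq0 -opprD oppr_eq0 gb.
apply/is_multiplierE; split=> [i k|i].
  rewrite mxE; have [->|ne] := eqVneq i i0; first by rewrite subrr.
  (* Raising the k-th coordinate at i and lowering it at i0 preserves the constraint, so [grad_b]
     does not depend on the knot; minus its common value is the multiplier. *)
  have := @minimizer_first_variation b y
    (fun j => ((j == i)%:R - (j == i0)%:R) *: delta_mx k 0) (fun=> 0) min.
  rewrite /first_variation [X in _ + X = 0]big1 ?addr0; last by move=> j _; rewrite mul0r.
  rewrite -scaler_suml sumrB.
  have s1 (j : 'I_N) : \sum_l (l == j)%:R = 1 :> R.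
    by rewrite -[RHS](sum_delta j (fun=> 1)); apply: eq_bigr => l _; rewrite mulr1.
  rewrite !s1 subrr scale0r => /(_ erefl).
  under eq_bigr do rewrite sum_delta_mx mulrBl.
  by rewrite sumrB !sum_delta.
have := @minimizer_first_variation b y (fun=> 0) (fun j => (j == i)%:R) min.
rewrite big1 // => /(_ erefl) <-; rewrite /first_variation.
rewrite big1 ?add0r; last by move=> j _; rewrite big1 // => k _; rewrite mxE mul0r.
by rewrite sum_delta.
Qed.

Lemma hfun_conv b y mu xi k : hfun a x b y mu xi k 0 = conv_phi (velocity b y k) xi + mu k 0.
Proof.
rewrite mxE summxE; congr (_ + _).
rewrite /conv_phi; under [X in itg _ _ X]eq_fun do rewrite mulr_suml.
rewrite itg_sum; last by move=> i; apply: nice_conv => //; exact: nice_velocity_term.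
apply: eq_bigr => i _; rewrite !mxE derive1_g g_conv -!conv_phi_shift //.
rewrite [X in X - _]mulrC [X in _ - X](_ : _ = y i * a i k 0 * itg 0 1 (fun t => dphi (t - x i) * phi (t - xi))); last by ring.
have nn l : nice l -> nice (fun t => l (t - x i) * phi (t - xi)).
  by move=> nl; apply: nice_conv => //; exact: nice_shift.
rewrite -!itgZ -?itgB; [|exact/niceZ/nn|exact/niceZ/nn|exact: nn|exact: nn].
by congr itg; apply/funext => t; ring.
Qed.

(** F carries the flux part of the residual and h its velocity part, since g is [phi] convolved with
    itself; the difference reassembles the whole residual. *)
Lemma Dfun_conv b y mu xi k :
  Dfun f a x qbar b y mu xi k 0 = - conv_phi (res b y k) xi - mu k 0.
Proof.
rewrite mxE [X in _ + X]mxE hfun_conv 2!mxE opprD addrA; congr (_ - _).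
rewrite -opprD; congr (- _).
transitivity (conv_phi (fun t => flux_deriv f a x qbar t k 0) xi + conv_phi (velocity b y k) xi).
  by congr (_ + _); rewrite /conv_phi /itg; apply: eq_Rintegral => t _; rewrite mxE mulrC.
rewrite /conv_phi -itgD; last 2 [exact: nice_conv].
  by congr itg; apply/funext => t; rewrite /res residualE; ring.
apply: nice_conv => //; exact: nice_velocity.
Qed.

Lemma derive1_Dfun b y mu xi k :
  derive1 (Dfun f a x qbar b y mu) xi k 0 = conv_dphi (res b y k) xi.
Proof.
have comp l : is_derive xi 1 (fun t => Dfun f a x qbar b y mu t l 0) (conv_dphi (res b y l) xi).
  under eq_fun do rewrite Dfun_conv.
  have H := is_derive_conv_phi xi (nice_residual b y l) (residual_per b y l).
  by apply: is_derive_eq; rewrite subr0 opprK.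
rewrite derive1E derive_mx; last first.
  by apply/derivable_mxP => l j; rewrite (ord1 j); have [] := comp l.
by rewrite mxE; have [_ ->] := comp k.
Qed.

End FirstVariation.

(** * Geometry of the knots *)

Section Line.
Context {R : realType} {d : nat} (k : 'I_d).
Implicit Types (F f : 'cV[R]_d -> 'cV[R]_d) (u v : 'cV[R]_d) (t : R).

Lemma is_derive_line F u v t : differentiable F (u + t *: v) ->
  is_derive t 1 (fun s : R => F (u + s *: v)) ('D_v F (u + t *: v)).
Proof.
move=> dF.
have E : (fun h : R => h^-1 *: (F (u + (h *: 1 + t) *: v) - F (u + t *: v))) =
         (fun h : R => h^-1 *: (F (h *: v + (u + t *: v)) - F (u + t *: v))).
  apply/funext => h; have -> : u + (h *: 1 + t) *: v = h *: v + (u + t *: v).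
    by rewrite addrCA -scalerDl; congr (_ + (_ + _) *: _); exact: mulr1.
  by [].
have := @diff_derivable _ _ _ F (u + t *: v) v dF.
by move=> dv; apply: DeriveDef; rewrite /derivable /derive /= E.
Qed.

Lemma is_derive_coord (G : R -> 'cV[R]_d) t (dG : 'cV[R]_d) :
  is_derive t 1 G dG -> is_derive t 1 (fun s => G s k 0) (dG k 0).
Proof.
move=> [dGt <-]; apply: DeriveDef; first by move/derivable_mxP : dGt => /(_ k 0).
by rewrite derive_mx // mxE.
Qed.

Lemma is_derive_line_coord F u v t : (forall w, differentiable F w) ->
  is_derive t 1 (fun s => F (u + s *: v) k 0) ('D_v F (u + t *: v) k 0).
Proof. by move=> dF; apply: is_derive_coord; exact: is_derive_line. Qed.

Lemma continuous_line_coord F u v : (forall w, differentiable F w) ->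
  continuous (fun s : R => F (u + s *: v) k 0).
Proof.
move=> dF t; apply: differentiable_continuous; apply/derivable1_diffP.
by have [] := is_derive_line_coord u v t dF.
Qed.

End Line.

Section Knots.
Context {R : realType} {N : nat} (x : 'I_N -> R).
Context (x01 : forall i, 0 <= x i < 1) (x_incr : forall i j : 'I_N, (i < j)%N -> x i < x j).
Implicit Types (i j : 'I_N) (t : R).

Definition gap i := knot_next x i - x i.
(* The representative of x_i - x_j modulo 1 that, increased by t, is the
   fractional part of x_i + t - x_j for every t in (0, gap i). *)
Definition offset i j : R := x i - x j + (i < j)%N%:R.

Lemma ordSE i : ordS i = (if i.+1 == N then 0 else i.+1) :> nat.
Proof.
rewrite /=; case: eqP => [->|]; first by rewrite modnn.
by move=> ne; rewrite modn_small // ltn_neqAle ltn_ord andbT; apply/eqP.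
Qed.

Lemma x_le i j : (i <= j)%N -> x i <= x j.
Proof.
rewrite leq_eqVlt => /predU1P[ij|/x_incr/ltW //]; by rewrite (val_inj ij).
Qed.

Lemma knot_next_le i j : knot_next x i <= x j + (j <= i)%N%:R.
Proof.
rewrite /knot_next; have := ordSE i; case: eqP => [iN oS|iN oS].
  rewrite (_ : (j <= i)%N); last by rewrite -ltnS iN.
  by rewrite lerD2r x_le // oS.
case: leqP => ji; rewrite /= ?addr0.
  by have /andP[_ /ltW h] := x01 (ordS i); have /andP[h' _] := x01 j; lra.
by rewrite x_le // oS.
Qed.

Lemma gap_gt0 i : 0 < gap i.
Proof.
rewrite /gap subr_gt0 /knot_next; have := ordSE i; case: eqP => [iN oS|iN oS].
  by have /andP[h _] := x01 (ordS i); have /andP[_ h'] := x01 i; rewrite /=; lra.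
by rewrite addr0 x_incr // oS.
Qed.

Lemma gap_le1 i : gap i <= 1.
Proof. by have := knot_next_le i i; rewrite leqnn /gap /=; lra. Qed.

Lemma delta_pE i : delta_p x i = gap i.
Proof.
by rewrite /delta_p gtr0_norm //; exact: gap_gt0.
Qed.

Lemma knot_prevE i : knot_prev x (ordS i) = x i - (i.+1 == N)%:R.
Proof. by rewrite /knot_prev ordSK ordSE; case: (_ == N). Qed.

Lemma delta_mE i : delta_m x (ordS i) = gap i.
Proof.
rewrite /delta_m knot_prevE distrC -(delta_pE i) /delta_p /knot_next.
by congr `| _ |; ring.
Qed.

Lemma offset_ge0 i j : 0 <= offset i j.
Proof.
rewrite /offset; case: ltnP => ij.
  by have /andP[h _] := x01 i; have /andP[_ h'] := x01 j; rewrite /=; lra.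
by rewrite addr0 subr_ge0 x_le.
Qed.

Lemma offset_gap_le1 i j : offset i j + gap i <= 1.
Proof.
rewrite /offset /gap; have := knot_next_le i j; rewrite leqNgt.
by case: ltnP => _ /=; lra.
Qed.

(** Only the offset from the knot just reached falls back, from 1 to 0. This single drop is the
    source of both jumps of the affine parts. *)
Lemma offset_ordS i j : offset (ordS i) j = offset i j + gap i - (j == ordS i)%:R.
Proof.
rewrite /offset /gap /knot_next.
(* Stated in the naturals so that the wrap-around i + 1 = N is settled by integer arithmetic. *)
have E : ((ordS i < j)%N + (j == ordS i) = (i < j)%N + (i.+1 == N))%N.
  have -> : (j == ordS i) = (j == ordS i :> nat) by [].
  by rewrite ordSE; have := ltn_ord j; have := ltn_ord i; case: (i.+1 =P N); lia.
have := congr1 (fun n => n%:R : R) E; rewrite /= !natrD; lra.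
Qed.

Lemma phi_offset i j t : 0 <= t <= gap i -> phi (t + x i - x j) = bern (t + offset i j).
Proof.
move=> /andP[t0 tg]; rewrite -phi_itv; last first.
  by have := offset_ge0 i j; have := offset_gap_le1 i j; lra.
by rewrite /offset !addrA per_nat.
Qed.

Lemma dphi_offset i j t : 0 < t < gap i -> dphi (t + x i - x j) = t + offset i j - 2^-1.
Proof.
move=> /andP[t0 tg]; rewrite -dphi_itv; last first.
  by have := offset_ge0 i j; have := offset_gap_le1 i j; lra.
by rewrite /offset !addrA per_nat //; exact: dphi_per.
Qed.

(* A knot x_i minimizing frac (t - x_i) works: otherwise x_(i+1) would do better. *)
Lemma knot_cover t : (0 < N)%N -> exists i, frac (t - x i) < gap i.
Proof.
move=> N0; case: (@Order.TotalTheory.arg_minP _ _ _ (Ordinal N0) xpredT (fun i => frac (t - x i))) => // i _ min_i.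
exists i; rewrite ltNge; apply/negP => gi; have := min_i (ordS i) isT.
have -> : frac (t - x (ordS i)) = frac (t - x i) - gap i.
  rewrite -[RHS]frac_id; last first.
    by have := frac_lt1 (t - x i); have := gap_gt0 i; lra.
  have -> : frac (t - x i) - gap i =
      (t - x (ordS i)) + (- (i.+1 == N)%:Z - Num.floor (t - x i))%:~R.
    by rewrite intrB mulrNz -pmulrn /gap /knot_next /Defs.frac; ring.
  by rewrite per_int //; exact: frac_per.
by have := gap_gt0 i; lra.
Qed.

Lemma sum_ordS (V : nmodType) (F : 'I_N -> V) : \sum_i F (ordS i) = \sum_i F i.
Proof. by rewrite [RHS](reindex_inj (can_inj (@ordSK N))). Qed.

(** All summands have the same quadratic coefficient in t, so weights of zero sum cancel it. Applied
    to [a] it makes q affine between knots, applied to [b] it does the same for the velocity. *)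
Lemma bern_offset_sum i t (w : 'I_N -> R) : \sum_j w j = 0 ->
  \sum_j w j * bern (t + offset i j) =
  \sum_j w j * bern (offset i j) + t * \sum_j w j * (offset i j - 2^-1).
Proof.
move=> w0; transitivity (\sum_j w j * bern (offset i j)
    + t * (\sum_j w j * (offset i j - 2^-1)) + t ^+ 2 / 2 * \sum_j w j); last first.
  by rewrite w0 mulr0 addr0.
by rewrite !mulr_sumr -!big_split /=; apply: eq_bigr => j _; rewrite /bern; field.
Qed.

End Knots.

(** * Patching functions along a finite measurable cover *)

Section Cover.
Context {R : realType}.

Lemma nice_comp_frac (h : R -> R) : nice h -> nice (fun t => h (frac t)).
Proof.
move=> [mh bh]; split; first exact: (measurableT_comp mh measurable_frac).
move=> A; have [K hK] := bh 1; exists K => t _; apply: hK.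
by rewrite ger0_norm ?frac_ge0 // ltW // frac_lt1.
Qed.

Lemma nice_point (c p : R) : nice (fun t => c * \1_[set p] t).
Proof.
split; first by apply: measurable_funM => //; exact: measurable_indic.
move=> A; exists `|c| => t _; rewrite normrM indicE ler_piMr //.
by case: (_ \in _); rewrite ?normr1 ?normr0.
Qed.

Lemma nice_cover (I : finType) (E : I -> set R) (m : I -> R -> R) (h : R -> R) :
  (forall i, measurable (E i)) -> (forall i, nice (m i)) ->
  (forall t, exists i, E i t) -> (forall i t, E i t -> h t = m i t) -> nice h.
Proof.
move=> mE nm cE hm; split.
  move=> _ Y mY; rewrite setTI.
  have -> : h @^-1` Y = \bigcup_(i in [set: I]) (E i `&` (m i @^-1` Y)).
    apply/seteqP; split=> t /=.
      by have [i Eit] := cE t; exists i => //; split=> //=; rewrite -hm.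
    by move=> [i _ [Eit /=]]; rewrite -hm.
  apply: fin_bigcup_measurable; first exact: finite_finset.
  move=> i _; apply: measurableI => //.
  by have [mi _] := nm i; rewrite -[X in measurable X]setTI; exact: mi.
move=> A; have [K hK] := choice (fun i => (nm i).2 A).
exists (\sum_i `|K i|) => t tA; have [i Eit] := cE t.
rewrite (hm _ _ Eit) (le_trans (hK i t tA)) // (bigD1 i) //=.
by rewrite (le_trans (ler_norm _)) // lerDl sumr_ge0.
Qed.

End Cover.

(** * Expansion on the pieces between knots *)

Section PieceIntegrals.
Context {R : realType} (P P1 P2 G : R -> R).
Implicit Types (s c t : R) (r : R -> R).
Context (dP : forall t, is_derive t 1 P (P1 t)) (dP1 : forall t, is_derive t 1 P1 (P2 t)).
Context (cP2 : continuous P2) (dG : forall t, -1 < t -> is_derive t 1 G (P t)).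

Lemma continuous_of_derive (F F1 : R -> R) :
  (forall t, is_derive t 1 F (F1 t)) -> continuous F.
Proof.
move=> dF t; apply: differentiable_continuous; apply/derivable1_diffP.
by have [] := dF t.
Qed.

Lemma is_derive_div (F : R -> R) l c t : is_derive (t / c) 1 F l ->
  is_derive t 1 (fun s => F (s / c)) (l / c).
Proof.
move=> dF; apply: (@is_derive1_comp _ F (fun s : R => s / c)) => //.
rewrite (_ : (fun s => s / c) = c^-1 \*: id); last by apply/funext => s; rewrite mulrC.
by apply: is_derive_eq; exact: mulr1.
Qed.

Lemma itg_affine_derive r s0 s1 c : 0 < c -> nice r ->
  (forall t, 0 < t < c -> r t = s0 + s1 * t + P1 (t / c) / c) ->
  itg 0 c r = s0 * c + s1 * c ^+ 2 / 2 + P 1 - P 0.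
Proof.
move=> c0 nr rE; pose h t := s0 + s1 * t + P1 (t / c) / c.
pose F t := s0 * t + s1 / 2 * (t * t) + P (t / c).
have ch : continuous h.
  apply: (@continuous_of_derive _ (fun t => s1 + P2 (t / c) / c / c)) => t.
  have H := is_derive_div (dP1 (t / c)).
  rewrite (_ : h = (fun t => s0 + s1 *: t + c^-1 *: P1 (t / c))); last first.
    by apply/funext => u; rewrite /h /GRing.scale /= [c^-1 * _]mulrC.
  by apply: is_derive_eq; rewrite /GRing.scale /=; field; rewrite gt_eqF.
have -> : itg 0 c r = itg 0 c h by apply: itg_ext; [exact: nr|exact: nice_continuous|exact: rE].
transitivity (F c - F 0); last by rewrite /F divff ?gt_eqF // (mul0r c^-1); ring.
apply: itg_derive; [exact: ltW|exact: ch|].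
move=> t _; have H := is_derive_div (dP (t / c)).
rewrite (_ : F = (fun t => s0 *: t + (s1 / 2) *: (t * t) + P (t / c))) //.
by apply: is_derive_eq; rewrite /GRing.scale /h /=; field; rewrite gt_eqF.
Qed.

(** Integrating (t - c) P1(t/c)/c by parts leaves minus the integral of P(t/c), that is - c (G 1 - G
    0). Here G 1 - G 0 is the mean of P over the unit interval, which the elimination must later
    absorb. *)
Lemma itg_affine_derive_moment r s0 s1 c : 0 < c -> nice r ->
  (forall t, 0 < t < c -> r t = s0 + s1 * t + P1 (t / c) / c) ->
  itg 0 c (fun t => r t * (t - c)) =
  - (s0 * c ^+ 2 / 2 + s1 * c ^+ 3 / 6) + c * P 0 - c * (G 1 - G 0).
Proof.
move=> c0 nr rE; pose h t := (s0 + s1 * t + P1 (t / c) / c) * (t - c).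
pose F t := s0 * (t * t / 2 - c * t) + s1 * (t * (t * t) / 3 - c / 2 * (t * t))
  + (t - c) * P (t / c) - c * G (t / c).
have nid : nice (fun t => t - c) by apply: niceB => //; exact: nice_cst.
have ch : continuous h.
  pose h1 t := s0 + s1 * t + P1 (t / c) / c.
  apply: (@continuous_of_derive _ (fun t => h1 t + (s1 + P2 (t / c) / c / c) * (t - c))) => t.
  have H := is_derive_div (dP1 (t / c)).
  rewrite (_ : h = (fun t => (s0 + s1 *: t + c^-1 *: P1 (t / c)) * (t - c))); last first.
    by apply/funext => u; rewrite /h /GRing.scale /= [c^-1 * _]mulrC.
  by apply: is_derive_eq; rewrite /GRing.scale /h1 /=; field; rewrite gt_eqF.
have -> : itg 0 c (fun t => r t * (t - c)) = itg 0 c h.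
  apply: itg_ext; [exact: niceM|exact: nice_continuous|].
  by move=> t /rE ->.
transitivity (F c - F 0); last by rewrite /F divff ?gt_eqF // (mul0r c^-1); field.
apply: itg_derive; [exact: ltW|exact: ch|].
move=> t /andP[t0 _]; have H := is_derive_div (dP (t / c)).
have H1 : is_derive t 1 (fun t => G (t / c)) (P (t / c) / c).
  by apply: is_derive_div; apply: dG; rewrite (lt_le_trans (_ : -1 < 0)) ?ltrN10 // divr_ge0 // ltW.
rewrite (_ : F = (fun t => s0 *: (2^-1 *: (t * t) - c *: t)
   + s1 *: (3^-1 *: (t * (t * t)) - (c / 2) *: (t * t)) + (t - c) * P (t / c) - c *: G (t / c))); last first.
  by apply/funext => u; rewrite /F /GRing.scale /=; field.
by apply: is_derive_eq; rewrite /GRing.scale /h /=; field; rewrite gt_eqF.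
Qed.

(** The weight 6 s (1 - s) vanishes at both ends and thus removes P1 from the boundary terms. Its
    derivative 6 - 12 s equals 6 and -6 there, and its second derivative is -12. *)
Lemma itg_parabola_derive2 :
  itg 0 1 (fun s => 6 * s * (1 - s) * P2 s) = 6 * P 1 + 6 * P 0 - 12 * (G 1 - G 0).
Proof.
pose F t := 6 * (t * (1 - t)) * P1 t - (6 - 12 * t) * P t - 12 * G t.
have cp : continuous (fun s : R => 6 * s * (1 - s)).
  apply: (@continuous_of_derive _ (fun s : R => 6 - 12 * s)) => t.
  rewrite (_ : (fun s => _) = (fun s : R => 6 *: (s * (1 - s)))); last first.
    by apply/funext => u; rewrite /GRing.scale /= mulrA.
  by apply: is_derive_eq; rewrite /GRing.scale /=; ring.
transitivity (F 1 - F 0); last by rewrite /F; ring.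
apply: itg_derive; first exact: ler01.
  by move=> t; apply: cvgM; [exact: cp|exact: cP2].
move=> t /andP[t0 _].
have H : is_derive t 1 G (P t) by apply: dG; lra.
have H1 := dP t; have H2 := dP1 t.
rewrite (_ : F = (fun t => (6 *: (t * (1 - t))) * P1 t - (6 - 12 *: t) * P t - 12 *: G t)) //.
by apply: is_derive_eq; rewrite /GRing.scale /=; ring.
Qed.

End PieceIntegrals.

(** * Block matrices acting on stacked vectors *)

Section Kronecker.
Context {R : realType} {d : nat}.

Lemma kron1_mx2 (p11 p12 p21 p22 : R) :
  kron1 d (mx2 p11 p12 p21 p22) =
  block_mx p11%:M p12%:M p21%:M p22%:M :> 'M[R]_(d + d).
Proof.
have eL (e : (d + d = (1 + 1) * d)%N) (i : 'I_d) :
    cast_ord e (lshift d i) = mxtens_index (lshift 1 0, i) by exact: val_inj.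
have eR (e : (d + d = (1 + 1) * d)%N) (i : 'I_d) :
    cast_ord e (rshift d i) = mxtens_index (rshift 1 0, i).
  by apply: val_inj; rewrite /= addn0 mul1n.
apply/matrixP => i j; rewrite /kron1 castmxE /mx2.
have sc (p : R) (u v : 'I_d) : (p%:M : 'M[R]_1) 0 0 * (1%:M : 'M[R]_d) u v = (p%:M : 'M[R]_d) u v.
  by rewrite !mxE eqxx mulr1n mulr_natr.
by case: (split_ordP i) => u ->; case: (split_ordP j) => v ->; rewrite ?(eL, eR) tensmxE
  ?(block_mxEul, block_mxEur, block_mxEdl, block_mxEdr) sc.
Qed.

Lemma kron1_mul (p11 p12 p21 p22 : R) (u v : 'cV[R]_d) :
  kron1 d (mx2 p11 p12 p21 p22) *m col_mx u v =
  col_mx (p11 *: u + p12 *: v) (p21 *: u + p22 *: v).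
Proof. by rewrite kron1_mx2 mul_block_col !mul_scalar_mx. Qed.

Lemma outer_mul (u v : 'cV[R]_d) : u *m u^T *m v = dotv u v *: u.
Proof.
rewrite -mulmxA; have -> : u^T *m v = (dotv u v)%:M.
  apply/matrixP => i j; rewrite (ord1 i) (ord1 j) mxE mxE eqxx mulr1n.
  by apply: eq_bigr => k _; rewrite mxE.
by rewrite mul_mx_scalar.
Qed.

End Kronecker.

(** * Affine pieces of the profile and increments of D between knots *)

Section Pieces.
Context {R : realType} {d N : nat} (f : 'cV[R]_d -> 'cV[R]_d).
Context (a : 'I_N -> 'cV[R]_d) (x : 'I_N -> R) (qbar : 'cV[R]_d).
Context (N_gt0 : (0 < N)%N) (f_smooth : smooth f) (sum_a : \sum_i a i = 0).
Context (x01 : forall i, 0 <= x i < 1) (x_incr : forall i j : 'I_N, (i < j)%N -> x i < x j).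
Implicit Types (i j : 'I_N) (k : 'I_d) (t : R).

Let q := profile a x qbar.
Let gap_pos i := gap_gt0 x01 x_incr i.

Definition chord i := q (knot_next x i) - q (x i).
Definition piece i k (s : R) := f (q (x i) + s *: chord i) k 0.
Definition piece1 i k (s : R) := 'D_(chord i) f (q (x i) + s *: chord i) k 0.
Definition piece2 i k (s : R) :=
  'D_(chord i) (fun u => 'D_(chord i) f u) (q (x i) + s *: chord i) k 0.

Lemma is_derive_piece i k t : is_derive t 1 (piece i k) (piece1 i k t).
Proof. by have [df _] := f_smooth 1; exact: is_derive_line_coord. Qed.

Lemma is_derive_piece1 i k t : is_derive t 1 (piece1 i k) (piece2 i k t).
Proof. by have [_ /(_ (chord i))[df _]] := f_smooth 2; exact: is_derive_line_coord. Qed.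

Lemma continuous_piece2 i k : continuous (piece2 i k).
Proof.
have [_ /(_ (chord i))[_ /(_ (chord i))[df _]]] := f_smooth 3.
exact: continuous_line_coord df.
Qed.

Lemma sum_coord (w : 'I_N -> 'cV[R]_d) k : \sum_i w i = 0 -> \sum_i w i k 0 = 0.
Proof. by move=> w0; rewrite -summxE w0 mxE. Qed.

Lemma knot_nextE i : knot_next x i = gap x i + x i.
Proof. by rewrite /gap subrK. Qed.

Lemma per_knot_next (V : Type) i (h : R -> V) : per h -> h (x (ordS i)) = h (knot_next x i).
Proof. by move=> ph; rewrite /knot_next per_nat. Qed.

Lemma profile_next i : q (knot_next x i) = q (x (ordS i)).
Proof. by apply/esym/per_knot_next; exact: profile_per. Qed.

Lemma profile_affine i t : 0 <= t <= gap x i ->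
  q (t + x i) = q (x i) + (t / gap x i) *: chord i.
Proof.
move=> tg; apply/colP => k; have gp := gap_pos i.
pose B := \sum_j a j k 0 * bern (offset x i j) + qbar k 0.
pose C := \sum_j a j k 0 * (offset x i j - 2^-1).
have qE s : 0 <= s <= gap x i -> q (s + x i) k 0 = B + s * C.
  move=> sg; rewrite /q /profile mxE summxE /B addrAC; congr (_ + _).
  rewrite /C -bern_offset_sum; last exact: sum_coord.
  by apply: eq_bigr => j _; rewrite mxE phi_offset // mulrC.
have q0 : q (x i) k 0 = B by rewrite -[x i]add0r qE ?mul0r ?addr0 // lexx ltW.
have coordE (s : R) (u v w : 'cV[R]_d) : (u + s *: (v - w)) k 0 = u k 0 + s * (v k 0 - w k 0).
  by rewrite !mxE.
rewrite qE // /chord knot_nextE coordE q0 qE ?lexx ?ltW //.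
by field; rewrite gt_eqF.
Qed.

Lemma flux_piece i k t : 0 < t < gap x i ->
  flux_deriv f a x qbar (t + x i) k 0 = piece1 i k (t / gap x i) / gap x i.
Proof.
move=> tg; rewrite /flux_deriv.
have D l : is_derive (t + x i) 1 (fun s => (f \o q) s l 0) (piece1 i l (t / gap x i) / gap x i).
  apply: (@near_eq_is_derive _ _ _ (fun s => piece i l ((s - x i) / gap x i))).
    near=> s; rewrite /piece [RHS]/= -[in RHS](subrK (x i) s) profile_affine //.
    have : s \in `]x i, knot_next x i[.
      by near: s; apply: near_in_itvoo; rewrite in_itv /= knot_nextE; lra.
    by rewrite in_itv /= knot_nextE; lra.
  have -> : piece1 i l (t / gap x i) / gap x i = piece1 i l (t / gap x i) / gap x i * 1 by rewrite mulr1.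
  apply: (@is_derive1_comp _ (fun s => piece i l (s / gap x i)) (fun s => s - x i)).
    by rewrite addrK; apply: is_derive_div; exact: is_derive_piece.
  by apply: is_derive_eq; rewrite subr0.
rewrite derive1E derive_mx; last first.
  by apply/derivable_mxP => l j; rewrite (ord1 j); have [] := D l.
by rewrite mxE; have [_ ->] := D k.
Unshelve. all: by end_near. Qed.

Lemma nice_flux k : nice (fun t => flux_deriv f a x qbar t k 0).
Proof.
pose h i t := piece1 i k (t / gap x i) / gap x i.
(* The gap between the unspecified value of the derivative at the corner x_i and its limit from the
   right; an indicator then makes [m i] exact on the half-open piece. *)
pose c i := flux_deriv f a x qbar (x i) k 0 - h i 0.
pose m i t := h i t + c i * \1_[set 0] t.
have nh i : nice (h i).
  apply: nice_continuous; apply: (@continuous_of_derive _ _ (fun t => piece2 i k (t / gap x i) / gap x i * (gap x i)^-1)) => t.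
  rewrite (_ : h i = (fun t => (gap x i)^-1 *: piece1 i k (t / gap x i))); last first.
    by apply/funext => s; rewrite /h mulrC.
  have H := is_derive_div (is_derive_piece1 i k (t / gap x i)).
  by apply: is_derive_eq; exact: mulrC.
apply: (@nice_cover _ _ (fun i => [set t | frac (t - x i) < gap x i]) (fun i t => m i (frac (t - x i)))).
- move=> i; have mf : measurable_fun [set: R] (fun t => frac (t - x i)).
    by apply: (measurableT_comp measurable_frac); exact: measurable_funB.
  have -> : [set t | frac (t - x i) < gap x i] = (fun t => frac (t - x i)) @^-1` `]-oo, gap x i[.
    by apply/seteqP; split => t /=; rewrite in_itv.
  by rewrite -[X in measurable X]setTI; exact: mf.
- move=> i; apply: (nice_shift (- x i)) (nice_comp_frac _).
  by apply: niceD => //; exact: nice_point.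
- by move=> t; exact: knot_cover.
move=> i t /= tg.
have -> : flux_deriv f a x qbar t = flux_deriv f a x qbar (frac (t - x i) + x i).
  have -> : frac (t - x i) + x i = t + (- Num.floor (t - x i))%:~R.
    by rewrite /Defs.frac mulrNz; ring.
  by apply/esym/(@per_int _ _ (flux_deriv f a x qbar)); exact: flux_per.
move: tg; have := frac_ge0 (t - x i); move: (frac (t - x i)) => u u0 ug.
rewrite /m; have [->|un0] := eqVneq u 0.
  by rewrite add0r indicE mem_set // mulr1 /c; ring.
rewrite indicE memNset ?mulr0 ?addr0 ?flux_piece //; first by rewrite lt_neqAle eq_sym un0 u0.
by move=> /= u0'; rewrite u0' eqxx in un0.
Qed.

Lemma AcoefE i k (G : R -> R) : (forall t, -1 < t -> is_derive t 1 G (piece i k t)) ->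
  Acoef f a x qbar i k 0 =
  gap x i ^- 2 * (6 * piece i k 1 + 6 * piece i k 0 - 12 * (G 1 - G 0)).
Proof.
move=> dG.
have [df /(_ (chord i))[d1f _]] := f_smooth 2.
have E1 : derive1 (fun s => f (q (x i) + s *: chord i)) =
    (fun s => 'D_(chord i) f (q (x i) + s *: chord i)).
  by apply/funext => u; rewrite derive1E; have [_ ->] := is_derive_line (df (q (x i) + u *: chord i)).
have E2 : derive1n 2 (fun s => f (q (x i) + s *: chord i)) =
    (fun s => 'D_(chord i) (fun u => 'D_(chord i) f u) (q (x i) + s *: chord i)).
  rewrite /derive1n [iter _ _ _]/= E1; apply/funext => u; rewrite derive1E.
  by have [_ ->] := is_derive_line (d1f (q (x i) + u *: chord i)).
have -> : Acoef f a x qbar i = (delta_p x i ^- 2) *: vint01 (fun s => (6 * s * (1 - s)) *: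
    derive1n 2 (fun s => f (q (x i) + s *: chord i)) s) by [].
rewrite E2.
rewrite (delta_pE x01 x_incr).
rewrite mxE.
rewrite [X in _ * X]mxE.
congr (_ * _).
rewrite -(itg_parabola_derive2 (is_derive_piece i k) (is_derive_piece1 i k) (@continuous_piece2 i k) dG).
congr (Rintegral _ _ _); apply/funext => s.
by rewrite mxE.
Qed.

Lemma piece_at0 i k : piece i k 0 = f (q (x i)) k 0.
Proof. by rewrite /piece scale0r addr0. Qed.

Lemma piece_at1 i k : piece i k 1 = f (q (knot_next x i)) k 0.
Proof. by rewrite /piece scale1r /chord addrC subrK. Qed.

Lemma BcoefE i k : Bcoef f a x qbar i k 0 = (piece i k 1 - piece i k 0) / gap x i.
Proof.
rewrite piece_at0 piece_at1 /Bcoef (delta_pE x01 x_incr) mulrC.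
by rewrite mxE; congr (_ * _); rewrite mxE; congr (_ + _); rewrite mxE.
Qed.

Lemma piece_ordS i k : piece (ordS i) k 0 = piece i k 1.
Proof. by rewrite piece_at0 piece_at1 profile_next. Qed.

Lemma itg_dphi : itg 0 1 (@dphi R) = 0.
Proof.
have nh : nice (fun t : R => t - 2^-1) by apply: niceB => //; exact: nice_cst.
rewrite (@itg_ext _ _ _ _ (fun t => t - 2^-1)) //; last exact: dphi_itv.
transitivity (bern 1 - bern 0 : R); last by rewrite /bern; field.
apply: itg_derive => [|t|t _]; [exact: ler01| |exact: is_derive_bern].
by apply: cvgB; [exact: cvg_id|exact: cvg_cst].
Qed.

Context (b : 'I_N -> 'cV[R]_d) (y : 'I_N -> R) (sum_b : \sum_i b i = 0).

(** The limit of the velocity at x_i from the right; [slope1] is its slope on the piece that starts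
    at x_i. *)
Definition slope0 i k :=
  \sum_j (b j k 0 * bern (offset x i j) - y j * a j k 0 * (offset x i j - 2^-1)).
Definition slope1 i k := \sum_j (b j k 0 * (offset x i j - 2^-1) - y j * a j k 0).

Lemma velocity_piece i k t : 0 < t < gap x i ->
  velocity a x b y k (t + x i) = slope0 i k + slope1 i k * t.
Proof.
move=> tg; transitivity (\sum_j b j k 0 * bern (t + offset x i j)
    - \sum_j y j * a j k 0 * (t + offset x i j - 2^-1)).
  rewrite -sumrB; apply: eq_bigr => j _; rewrite dphi_offset // phi_offset //.
  by case/andP: tg => /ltW -> /ltW ->.
rewrite bern_offset_sum ?sum_coord // /slope0 /slope1 mulr_suml mulr_sumr -!big_split /= -sumrB.
by apply: eq_bigr => j _; ring.
Qed.

Lemma slope1_ordS i k : slope1 (ordS i) k = slope1 i k - b (ordS i) k 0.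
Proof.
transitivity (slope1 i k + gap x i * (\sum_j b j k 0) - \sum_j (j == ordS i)%:R * b j k 0).
  rewrite /slope1 mulr_sumr -big_split -sumrB; apply: eq_bigr => j _ /=.
  by rewrite offset_ordS //; ring.
by rewrite sum_coord // mulr0 addr0 sum_delta.
Qed.

Lemma slope0_ordS i k :
  slope0 (ordS i) k = slope0 i k + slope1 i k * gap x i + y (ordS i) * a (ordS i) k 0.
Proof.
(* The drop of the offset from 1 to 0 is invisible to [bern]: phi is continuous, so only the [dphi]
   terms make the velocity jump. *)
have bS j : bern (offset x (ordS i) j) = bern (gap x i + offset x i j).
  rewrite offset_ordS // [gap x i + _]addrC; have [->|_] := eqVneq j (ordS i); last by rewrite subr0.
  have : offset x (ordS i) (ordS i) = 0 by rewrite /offset subrr ltnn addr0.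
  rewrite offset_ordS // eqxx => /= /eqP; rewrite subr_eq0 => /eqP ->.
  by rewrite /bern; field.
transitivity (\sum_j b j k 0 * bern (gap x i + offset x i j)
    - \sum_j y j * a j k 0 * (gap x i + offset x i j - 2^-1)
    + \sum_j (j == ordS i)%:R * (y j * a j k 0)).
  rewrite /slope0 -sumrB -big_split; apply: eq_bigr => j _ /=.
  by rewrite bS offset_ordS //; ring.
rewrite sum_delta bern_offset_sum ?sum_coord //; congr (_ + _).
rewrite /slope0 /slope1 mulr_suml mulr_sumr -!big_split /= -sumrB.
by apply: eq_bigr => j _ /=; ring.
Qed.

Let r k t := residual f a x qbar b y t k 0.
Let nr k : nice (r k) := nice_residual nice_flux b y k.
Let pr k : per (r k) := residual_per f a x qbar b y k.

Lemma residual_piece i k t : 0 < t < gap x i ->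
  r k (t + x i) = slope0 i k + slope1 i k * t + piece1 i k (t / gap x i) / gap x i.
Proof. by move=> tg; rewrite /r residualE velocity_piece // flux_piece. Qed.

Let gap01 i : 0 <= gap x i <= 1.
Proof. by rewrite ltW ?gap_le1. Qed.

Lemma cyclic_increment (A B w : 'I_N -> R) (c : R) :
  (forall i, A (ordS i) = A i - w i * c + B i) -> \sum_i w i = 1 -> c = \sum_i B i.
Proof.
move=> step w1; have := sum_ordS A.
under eq_bigr do rewrite step.
by rewrite big_split sumrB -mulr_suml w1 mul1r /=; lra.
Qed.

(* Summing the increments of conv_dphi over one period of knots turns the
   integral over [0, 1] into the sum of the integrals over the pieces. *)
Lemma itg_pieces (h : R -> R) : nice h -> per h ->
  itg 0 1 h = \sum_i itg 0 (gap x i) (fun t => h (t + x i)).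
Proof.
move=> nh ph.
have S1 : \sum_i gap x i = 1.
  rewrite /gap /knot_next sumrB big_split /= (sum_ordS x) addrAC subrr add0r.
  have NP : (N.-1 < N)%N by rewrite prednK.
  rewrite (bigD1 (Ordinal NP)) //= prednK // eqxx big1 ?addr0 // => j jN.
  case: eqP => // jN'; case/eqP: jN; apply: val_inj => /=; lia.
have step i : conv_dphi h (x (ordS i)) =
    conv_dphi h (x i) - gap x i * itg 0 1 h + itg 0 (gap x i) (fun t => h (t + x i)).
  rewrite -(conv_dphi_taylor (x i) nh ph (gap01 i)).
  by rewrite (per_knot_next i (conv_dphi_per h)) addrC -knot_nextE.
exact: (@cyclic_increment (fun i => conv_dphi h (x i)) _ (gap x) _ step S1).
Qed.

(** Because of the corners of f(q), the fundamental theorem is applied on each piece separately;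
    continuity at the knots and periodicity make the end values telescope around the cycle. *)
Lemma itg_flux k : itg 0 1 (fun t => flux_deriv f a x qbar t k 0) = 0.
Proof.
rewrite itg_pieces; [|exact: nice_flux|by move=> t; rewrite flux_per].
transitivity (\sum_i (piece (ordS i) k 0 - piece i k 0)); last first.
  by rewrite sumrB (sum_ordS (fun i => piece i k 0)) subrr.
apply: eq_bigr => i _; rewrite piece_ordS.
rewrite (itg_affine_derive (is_derive_piece i k) (is_derive_piece1 i k) (s0 := 0) (s1 := 0) (gap_pos i)).
- by ring.
- exact: (nice_shift (x i) (nice_flux k)).
- by move=> t tg; rewrite flux_piece //; ring.
Qed.

(** This removes the terms with the total integral from both Taylor formulas, leaving increments
    that depend on one piece only. *)
Lemma itg_residual k : itg 0 1 (r k) = 0.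
Proof.
transitivity (itg 0 1 (fun t => velocity a x b y k t + flux_deriv f a x qbar t k 0)).
  by congr (itg _ _ _); apply/funext => t; rewrite /r residualE.
rewrite itgD; [|exact: nice_velocity|exact: nice_flux].
rewrite itg_flux addr0 itg_sum; last by move=> i; exact: nice_velocity_term.
transitivity (\sum_i b i k 0 * itg 0 1 (@phi R)); last by rewrite -mulr_suml sum_coord ?mul0r.
apply: eq_bigr => i _.
have np : nice (fun t => phi (t - x i)) by exact: nice_shift.
have nd : nice (fun t => dphi (t - x i)) by exact: nice_shift.
rewrite (itgB 0 1 (niceZ _ np) (niceZ _ nd)) (itgZ 0 1 _ np) (itgZ 0 1 _ nd).
by rewrite (itg_per _ nice_phi phi_per) (itg_per _ nice_dphi dphi_per) itg_dphi mulr0 subr0.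
Qed.

Lemma conv_dphi_residual_step i k :
  conv_dphi (r k) (x (ordS i)) = conv_dphi (r k) (x i)
    + (slope0 i k * gap x i + slope1 i k * gap x i ^+ 2 / 2 + piece i k 1 - piece i k 0).
Proof.
apply: etrans (per_knot_next i (conv_dphi_per (r k))) _.
apply: etrans (congr1 (conv_dphi (r k)) (etrans (knot_nextE i) (addrC _ _))) _.
apply: etrans (conv_dphi_taylor (x i) (nr k) (pr k) (gap01 i)) _.
rewrite itg_residual mulr0 subr0; congr (_ + _).
exact: (itg_affine_derive (is_derive_piece i k) (is_derive_piece1 i k) (gap_pos i)
   (nice_shift (x i) (nr k)) (fun t tg => residual_piece k tg)).
Qed.

Lemma conv_phi_residual_step i k (G : R -> R) :
  (forall t, -1 < t -> is_derive t 1 G (piece i k t)) ->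
  conv_phi (r k) (x (ordS i)) = conv_phi (r k) (x i) - gap x i * conv_dphi (r k) (x i)
    - (slope0 i k * gap x i ^+ 2 / 2 + slope1 i k * gap x i ^+ 3 / 6)
    + gap x i * piece i k 0 - gap x i * (G 1 - G 0).
Proof.
move=> dG.
apply: etrans (per_knot_next i (conv_phi_per (r k))) _.
apply: etrans (congr1 (conv_phi (r k)) (etrans (knot_nextE i) (addrC _ _))) _.
apply: etrans (conv_phi_taylor (x i) (nr k) (pr k) (gap01 i)) _.
rewrite itg_residual mulr0 addr0 -[RHS]addrA -[RHS]addrA; congr (_ + _).
apply: etrans (itg_affine_derive_moment (is_derive_piece i k) (is_derive_piece1 i k) dG (gap_pos i)
   (nice_shift (x i) (nr k)) (fun t tg => residual_piece k tg)) _.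
by rewrite addrA.
Qed.

Context (mu : 'cV[R]_d).
Let D := Dfun f a x qbar b y mu.
Lemma derive1_Dfun_step i k :
  derive1 D (x (ordS i)) k 0 = derive1 D (x i) k 0
    + (slope0 i k * gap x i + slope1 i k * gap x i ^+ 2 / 2 + piece i k 1 - piece i k 0).
Proof.
have E xi : derive1 D xi k 0 = conv_dphi (r k) xi by exact: derive1_Dfun nice_flux b y mu xi k.
apply: etrans (E _) _; apply: etrans (conv_dphi_residual_step i k) _.
by congr (_ + _); exact/esym/E.
Qed.

Lemma Dfun_step i k (G : R -> R) : (forall t, -1 < t -> is_derive t 1 G (piece i k t)) ->
  D (x (ordS i)) k 0 = D (x i) k 0 + gap x i * derive1 D (x i) k 0
    + (slope0 i k * gap x i ^+ 2 / 2 + slope1 i k * gap x i ^+ 3 / 6)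
    - gap x i * piece i k 0 + gap x i * (G 1 - G 0).
Proof.
move=> /conv_phi_residual_step H.
have E xi : derive1 D xi k 0 = conv_dphi (r k) xi by exact: derive1_Dfun nice_flux b y mu xi k.
have F xi : D xi k 0 = - conv_phi (r k) xi - mu k 0 by exact: Dfun_conv nice_flux b y mu xi k.
have alg (d1 d0 e0 p1 p0 q0 m c u v w : R) : p1 = p0 - c * q0 - u + v - w ->
    d1 = - p1 - m -> d0 = - p0 - m -> e0 = q0 -> d1 = d0 + c * e0 + u - v + w.
  by move=> -> -> -> ->; ring.
exact: alg H (F _) (F _) (E _).
Qed.

End Pieces.

(** * The block tridiagonal system *)

Section System.
Context {R : realType} {d : nat}.

Lemma block_system (la lx c e : R) (a u0 v0 u1 v1 u2 v2 A A' B B' : 'cV[R]_d) :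
  (forall k, - 12 * c ^- 3 * u0 k 0 - 6 * c ^- 2 * v0 k 0
    + 12 * (e ^- 3 + c ^- 3) * u1 k 0 + 6 * (e ^- 2 - c ^- 2) * v1 k 0 + la^-1 * u1 k 0
    - 12 * e ^- 3 * u2 k 0 + 6 * e ^- 2 * v2 k 0 = A k 0 - A' k 0) ->
  (forall k, 6 * c ^- 2 * u0 k 0 + 2 * c^-1 * v0 k 0
    + 6 * (e ^- 2 - c ^- 2) * u1 k 0 + 4 * (e^-1 + c^-1) * v1 k 0
    + lx^-1 * dotv a v1 * a k 0
    - 6 * e ^- 2 * u2 k 0 + 2 * e^-1 * v2 k 0 =
    - (B k 0 - e / 2 * A k 0) + (B' k 0 + c / 2 * A' k 0)) ->
  kron1 d (mx2 (- 12 * c ^- 3) (- 6 * c ^- 2) (6 * c ^- 2) (2 * c^-1)) *m col_mx u0 v0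
  + (kron1 d (mx2 (12 * (e ^- 3 + c ^- 3)) (6 * (e ^- 2 - c ^- 2))
                  (6 * (e ^- 2 - c ^- 2)) (4 * (e^-1 + c^-1)))
     + block_mx (la^-1)%:M 0 0 (lx^-1 *: (a *m a^T))) *m col_mx u1 v1
  + kron1 d (mx2 (- 12 * e ^- 3) (6 * e ^- 2) (- 6 * e ^- 2) (2 * e^-1)) *m col_mx u2 v2
  = col_mx (A - A') (- (B - (e / 2) *: A) + (B' + (c / 2) *: A')).
Proof.
move=> row1 row2; rewrite mulmxDl !kron1_mul mul_block_col !mul0mx mul_scalar_mx addr0 add0r.
rewrite -scalemxAl outer_mul !add_col_mx; congr col_mx; apply/colP => k; rewrite !mxE.
  by rewrite -row1; ring.
by rewrite -row2; ring.
Qed.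

(* The Hermite data (u0, v0), (u1, v1), (u2, v2) of a function whose second
   derivative on the two pieces, of lengths c and e, is an affine function plus
   the derivative of p; gam and eta are the means of p over the pieces, and b
   and w the jumps of the affine parts. *)
Lemma hermite_system (c e u0 v0 u1 v1 u2 v2 s0 s1 t0 t1 p0 p1 q1 q2 gam eta b w A A' B B' : R) :
  c != 0 -> e != 0 -> q1 = p1 ->
  u1 = u0 + c * v0 + (s0 * c ^+ 2 / 2 + s1 * c ^+ 3 / 6) - c * p0 + c * gam ->
  v1 = v0 + (s0 * c + s1 * c ^+ 2 / 2 + p1 - p0) ->
  u2 = u1 + e * v1 + (t0 * e ^+ 2 / 2 + t1 * e ^+ 3 / 6) - e * q1 + e * eta ->
  v2 = v1 + (t0 * e + t1 * e ^+ 2 / 2 + q2 - q1) ->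
  t1 = s1 - b -> t0 = s0 + s1 * c + w ->
  A = e ^- 2 * (6 * q2 + 6 * q1 - 12 * eta) ->
  A' = c ^- 2 * (6 * p1 + 6 * p0 - 12 * gam) ->
  B = (q2 - q1) / e -> B' = (p1 - p0) / c ->
  - 12 * c ^- 3 * u0 - 6 * c ^- 2 * v0 + 12 * (e ^- 3 + c ^- 3) * u1
    + 6 * (e ^- 2 - c ^- 2) * v1 + b - 12 * e ^- 3 * u2 + 6 * e ^- 2 * v2 = A - A' /\
  6 * c ^- 2 * u0 + 2 * c^-1 * v0 + 6 * (e ^- 2 - c ^- 2) * u1
    + 4 * (e^-1 + c^-1) * v1 + w - 6 * e ^- 2 * u2 + 2 * e^-1 * v2 =
  - (B - e / 2 * A) + (B' + c / 2 * A').
Proof.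
(* With everything expressed through the data of the first piece, the jumps, q2 and the two means,
   both equations become rational identities in c and e. *)
move=> c0 e0 -> hu1 hv1 -> -> -> -> -> -> -> ->; rewrite hu1 hv1.
by split; field; rewrite c0 e0.
Qed.

End System.

Theorem mainTheorem2 (R : realType) (d N : nat) (f : 'cV[R]_d -> 'cV[R]_d)
    (la lx : R) (qbar : 'cV[R]_d) (a : 'I_N -> 'cV[R]_d) (x : 'I_N -> R)
    (da : 'I_N -> 'cV[R]_d) (dx : 'I_N -> R) :
  (3 <= N)%N ->
  smooth f ->
  0 < la -> 0 < lx ->
  \sum_i a i = 0 ->
  (forall i, 0 <= x i < 1) ->
  (forall i j : 'I_N, (i < j)%N -> x i < x j) ->
  is_constrained_minimizer f la lx a x qbar da dx ->
  (exists! alpha : 'cV[R]_d, is_multiplier f la lx a x qbar da dx (2 *: alpha)) /\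
  forall alpha : 'cV[R]_d,
    is_multiplier f la lx a x qbar da dx (2 *: alpha) ->
    let D := Dfun f a x qbar da dx alpha in
    let Z := Zvec f a x qbar da dx alpha in
    forall i : 'I_N,
      [/\ D (x i) = la *: da i,
          dotv (a i) (derive1 D (x i)) = lx * dx i
        & Gprev d x i *m Z (ord_pred i) + Gdiag la lx a x i *m Z i
            + Gnext d x i *m Z (ordS i) = rhs f a x qbar i].
Proof.
move=> N3 sf la0 lx0 sa x01 xinc min.
have N0 : (0 < N)%N by exact: leq_trans N3.
have sb : \sum_i da i = 0 by case: min.
have nf := nice_flux qbar N0 sf sa x01 xinc.
split; first exact: (multiplier_exists nf N0 min).
move=> mu mult; have [gb gy] := (is_multiplierE la lx nf da dx mu).1 mult.
move=> D Z.
have DE i : D (x i) = la *: da i.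
  apply/colP => k; apply: etrans (Dfun_conv nf da dx mu (x i) k) _.
  rewrite [RHS]mxE; have := gb i k; rewrite /grad_b.
  by move: (conv_phi _ _) (la * _) (mu k 0) => p q m; lra.
have dDE i : dotv (a i) (derive1 D (x i)) = lx * dx i.
  have /eqP := gy i; rewrite /grad_y subr_eq0 => /eqP ->.
  by apply: eq_bigr => k _; congr (_ * _); exact: derive1_Dfun nf da dx mu (x i) k.
move=> i0; split; [exact: DE|exact: dDE|].
(* Every increment goes from a knot to its successor, so the central knot is renamed as the
   successor of j: piece j lies to its left and piece i to its right. *)
rewrite -(ord_predK i0); move: (ord_pred i0) => j; rewrite ordSK; set i := ordS j.
have gj := gap_gt0 x01 xinc j; have gi := gap_gt0 x01 xinc i.
have prim (l : 'I_N) (k : 'I_d) : exists G : R -> R, forall t : R, -1 < t -> is_derive t 1 G (piece f a x qbar l k t).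
  by apply: primitive; apply: continuous_of_derive => t; exact: is_derive_piece.
have herm (k : 'I_d) := fun G H (dG : forall t : R, -1 < t -> is_derive t 1 G (piece f a x qbar j k t))
    (dH : forall t : R, -1 < t -> is_derive t 1 H (piece f a x qbar i k t)) =>
  hermite_system (lt0r_neq0 gj) (lt0r_neq0 gi) (piece_ordS f a x qbar j k)
   (Dfun_step N0 sf sa x01 xinc dx sb mu dG)
   (derive1_Dfun_step qbar N0 sf sa x01 xinc dx sb mu j k)
   (Dfun_step N0 sf sa x01 xinc dx sb mu dH)
   (derive1_Dfun_step qbar N0 sf sa x01 xinc dx sb mu i k)
   (slope1_ordS a x dx sb j k) (slope0_ordS a x dx sb j k)
   (AcoefE sf x01 xinc dH) (AcoefE sf x01 xinc dG)
   (BcoefE f a qbar x01 xinc i k) (BcoefE f a qbar x01 xinc j k).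
rewrite /Gprev /Gdiag /Gnext /rhs ordSK (delta_mE x01 xinc j) (delta_pE x01 xinc i).
apply: block_system => k; have [G dG] := prim j k; have [H dH] := prim i k.
  (* Here the system closes: the jump [da i] of the slope is [la^-1] times the unknown [D (x i)],
     and in the second row the jump [dx i] times [a i] likewise becomes the term with the outer
     product of [a i]. *)
  have -> : la^-1 * D (x i) k 0 = da i k 0 by rewrite DE mxE mulKf ?gt_eqF.
  exact: (herm k G H dG dH).1.
have -> : lx^-1 * dotv (a i) (derive1 D (x i)) * a i k 0 = dx i * a i k 0.
  by rewrite dDE mulKf ?gt_eqF.
exact: (herm k G H dG dH).2.
Qed.
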